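(* Let $\Gamma$ be a finite group acting faithfully and linearly on a finite-dimensional real vector space $V$. Then any constant Poisson structure on $S(V^* )\rtimes\Gamma$ is quantizable.
   Context: All vector spaces and algebras are over $\mathbb{R}$. Fix a $\Gamma$-invariant inner product on $V$. For $\gamma\in\Gamma$, let $V^\gamma$ be the fixed subspace, $N^\gamma=(V^\gamma)^\perp\subset V$, and $l(\gamma)=\dim_{\mathbb R} N^\gamma$. Thus $V=V^\gamma\oplus N^\gamma$ and $V^*=(V^\gamma)^*\oplus (N^\gamma)^*$, where $(V^\gamma)^*$ is identified with the functionals vanishing on $N^\gamma$. $A=S(V^* )\rtimes\Gamma$ is the crossed product of the polynomial algebra $S(V^* )$ with $\Gamma$, with $\gamma x={}^\gamma x\,\gamma$ for $x\in V^*$. The group $\Gamma$ acts on families $(f_\gamma)_{\gamma\in\Gamma}$, $f_\gamma\in S(V^* )\otimes\wedge^\bullet V$, by $(g\cdot f)_{g\gamma g^{-1}}=g(f_\gamma)$, and $(\cdot)^\Gamma$ denotes invariants. Let $\mathsf{pr}_\gamma: S(V^* )\otimes\wedge^n V\to S((V^\gamma)^* )\otimes\wedge^{n-l(\gamma)}V^\gamma\otimes\wedge^{l(\gamma)}N^\gamma$ be the projection determined by $V=V^\gamma\oplus N^\gamma$ (restrict polynomials to $V^\gamma$, project polyvectors). It is known that $H^n(A,A)\cong\big(\bigoplus_{\gamma\in\Gamma}S((V^\gamma)^* )\otimes\wedge^{n-l(\gamma)}V^\gamma\otimes\wedge^{l(\gamma)}N^\gamma\big)^\Gamma$. For $n=2$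 the isomorphism is as follows. Every class is represented by an $\mathbb{R}\Gamma$-bilinear cocycle $m$ (that is, $m(\gamma a,b)=\gamma m(a,b)$, $m(a\gamma,b)=m(a,\gamma b)$, $m(a,b\gamma)=m(a,b)\gamma$); writing $m(x,y)-m(y,x)=\sum_\gamma f_\gamma(x,y)\gamma$ for $x,y\in V^*$, with $f_\gamma\in S(V^* )\otimes\wedge^2V$, the class goes to $(\mathsf{pr}_\gamma f_\gamma)_\gamma$. A constant Poisson structure on $A$ is an element $\pi=\pi_0+\sum_{l(\gamma)=2}\pi_\gamma$ of $(\wedge^2V)^\Gamma\oplus\big(\bigoplus_{\gamma\in\Gamma,\ l(\gamma)=2}\wedge^2N^\gamma\big)^\Gamma\subset H^2(A,A)$ ($\pi_0$ sits at the identity of $\Gamma$); its Gerstenhaber bracket with itself is automatically zero. A Poisson structure $\pi\in H^2(A,A)$ is quantizable if there is an associative $\mathbb{R}[[\hbar]]$-bilinear product $a\star b=ab+\sum_{k\ge1}\hbar^k m_k(a,b)$ ($a,b\in A$) on $A[[\hbar]]$ such that the Hochschild 2-cocycle $m_1$ has class $\pi$ in $H^2(A,A)$. *)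

(* Defs.v *)
From HB Require Import structures.
From mathcomp Require Import all_boot all_order all_algebra all_fingroup.
From mathcomp Require Import mxrepresentation sesquilinear reals.
From mathcomp Require Import mpoly.

Set Implicit Arguments.
Unset Strict Implicit.
Unset Printing Implicit Defensive.

Import Order.TTheory GRing.Theory Num.Theory.

Local Open Scope ring_scope.

(* V is the space 'cV[R]_n of column vectors and S(V^* ) is {mpoly R[n]}, with
   'X_i the i-th coordinate function.  A representation rG acts on the left of
   V by v |-> rG g *m v. *)

Section LinearSubstitution.
Context {R : realType} {n : nat}.
Implicit Types (M N : 'M[R]_n) (p q : {mpoly R[n]}).

(* The polynomial function v |-> p (M v). *)
Definition mpoly_lin M p : {mpoly R[n]} :=
  p \mPo [tuple \sum_(j < n) M i j *: 'X_j | i < n].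

Lemma mpoly_linD M : {morph mpoly_lin M : p q / p + q}.
Proof. exact: comp_mpolyD. Qed.

Lemma mpoly_linZ M c p : mpoly_lin M (c *: p) = c *: mpoly_lin M p.
Proof. exact: comp_mpolyZ. Qed.

Lemma mpoly_linM M : {morph mpoly_lin M : p q / p * q}.
Proof. by move=> p q; rewrite /mpoly_lin rmorphM. Qed.

Lemma mpoly_lin_const M c : mpoly_lin M c%:MP = c%:MP.
Proof. exact: comp_mpolyC. Qed.

Lemma mpoly_lin_sum M (I : Type) (r : seq I) (P : pred I)
    (F : I -> {mpoly R[n]}) :
  mpoly_lin M (\sum_(i <- r | P i) F i) = \sum_(i <- r | P i) mpoly_lin M (F i).
Proof. exact: raddf_sum. Qed.

Lemma mpoly_linX M i : mpoly_lin M 'X_i = \sum_(j < n) M i j *: 'X_j.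
Proof. by rewrite /mpoly_lin comp_mpolyXU -tnth_nth tnth_mktuple. Qed.

Lemma mpoly_lin1 p : mpoly_lin 1%:M p = p.
Proof.
rewrite -[RHS]comp_mpoly_id; congr (_ \mPo _); apply: eq_mktuple => i.
rewrite (bigD1 i) //= mxE eqxx scale1r big1 ?addr0 // => j ji.
by rewrite mxE eq_sym (negbTE ji) scale0r.
Qed.

Lemma mpoly_lin_comp M N p : mpoly_lin N (mpoly_lin M p) = mpoly_lin (M *m N) p.
Proof.
rewrite [p]mpolyE.
rewrite (mpoly_lin_sum M (msupp p)) !(mpoly_lin_sum _ (msupp p)).
apply: eq_bigr => m _; rewrite !mpoly_linZ; congr (_ *: _); rewrite mpolyXE_id.
have prodE K (F : 'I_n -> {mpoly R[n]}) :
    mpoly_lin K (\prod_(i < n) F i ^+ m i) =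
    \prod_(i < n) mpoly_lin K (F i) ^+ m i.
  rewrite /mpoly_lin rmorph_prod /=; apply: eq_bigr => i _; exact: rmorphXn.
rewrite !prodE.
apply: eq_bigr => i _; congr (_ ^+ _); rewrite !mpoly_linX mpoly_lin_sum.
under eq_bigr do rewrite mpoly_linZ mpoly_linX scaler_sumr.
rewrite exchange_big; apply: eq_bigr => j _.
rewrite mxE scaler_suml; apply: eq_bigr => k _; exact: scalerA.
Qed.

End LinearSubstitution.

(* The family a stands for \sum_g a_g g, with coefficients on the left.  The
   type does not depend on rG, which only selects the ring structure below. *)
Definition crossed (R : realType) (gT : finGroupType) (n : nat)
    (rG : mx_representation R [set: gT] n) : Type :=
  {ffun gT -> {mpoly R[n]}}.

Section CrossedProduct.
Context {R : realType} {gT : finGroupType} {n : nat}.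
Context (rG : mx_representation R [set: gT] n).
Local Notation crossed := (crossed rG).

HB.instance Definition _ := GRing.Lmodule.on crossed.

(* The action on functions, (g . p)(v) = p (g^-1 v). *)
Definition poly_act (g : gT) (p : {mpoly R[n]}) : {mpoly R[n]} :=
  mpoly_lin (rG g^-1%g) p.

Implicit Types (a b c : crossed).

(* (p h)(q k) = p (h . q) hk *)
Definition crossed_mul a b : crossed :=
  [ffun g => \sum_(h : gT) a h * poly_act h (b (h^-1 * g)%g)].

Definition crossed_one : crossed := [ffun g => (g == 1%g)%:R].

Lemma poly_act1 p : poly_act 1%g p = p.
Proof. by rewrite /poly_act invg1 repr_mx1 mpoly_lin1. Qed.

Lemma poly_actM g h p : poly_act (g * h)%g p = poly_act g (poly_act h p).
Proof. by rewrite /poly_act mpoly_lin_comp -repr_mxM ?inE // invMg. Qed.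

Lemma poly_act_nat g k : poly_act g k%:R = k%:R.
Proof. by rewrite /poly_act -mpolyC_nat mpoly_lin_const. Qed.

Lemma crossed_mulA : associative crossed_mul.
Proof.
move=> a b c; apply/ffunP => g; rewrite !ffunE.
transitivity (\sum_h \sum_k
    a k * poly_act k (b (k^-1 * h)%g) * poly_act h (c (h^-1 * g)%g)); last first.
  by apply: eq_bigr => h _; rewrite ffunE mulr_suml.
rewrite exchange_big; apply: eq_bigr => k _; rewrite ffunE.
rewrite [poly_act k _]mpoly_lin_sum mulr_sumr.
rewrite [RHS](reindex_inj (mulgI k)) /=; apply: eq_bigr => h _.
by rewrite [X in _ * X]mpoly_linM mulrA mulKg poly_actM invMg mulgA.
Qed.

Lemma crossed_mul1r : left_id crossed_one crossed_mul.
Proof.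
move=> a; apply/ffunP => g; rewrite !ffunE (bigD1 1%g) //= big1 => [|h h1].
  by rewrite ffunE eqxx mul1r invg1 mul1g poly_act1 addr0.
by rewrite ffunE (negbTE h1) mul0r.
Qed.

Lemma crossed_mulr1 : right_id crossed_one crossed_mul.
Proof.
move=> a; apply/ffunP => g; rewrite !ffunE (bigD1 g) //= big1 => [|h hg].
  by rewrite ffunE mulVg eqxx poly_act_nat mulr1 addr0.
rewrite ffunE poly_act_nat -eq_mulVg1 (negbTE hg); exact: mulr0.
Qed.

Lemma crossed_mulDl : left_distributive crossed_mul +%R.
Proof.
move=> a b c; apply/ffunP => g; rewrite !ffunE -big_split /=.
by apply: eq_bigr => h _; rewrite ffunE mulrDl.
Qed.

Lemma crossed_mulDr : right_distributive crossed_mul +%R.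
Proof.
move=> a b c; apply/ffunP => g; rewrite !ffunE -big_split /=.
by apply: eq_bigr => h _; rewrite ffunE [poly_act _ _]mpoly_linD mulrDr.
Qed.

Lemma crossed_one_neq0 : crossed_one != 0.
Proof.
apply/eqP => /ffunP/(_ 1%g)/eqP; rewrite !ffunE eqxx; exact/negP/oner_neq0.
Qed.

HB.instance Definition _ := GRing.Zmodule_isNzRing.Build crossed
  crossed_mulA crossed_mul1r crossed_mulr1 crossed_mulDl crossed_mulDr
  crossed_one_neq0.

Lemma crossed_scalerAl (k : R) a b : k *: (a * b) = (k *: a) * b.
Proof.
apply/ffunP => g; rewrite !ffunE scaler_sumr.
by apply: eq_bigr => h _; rewrite ffunE scalerAl.
Qed.

HB.instance Definition _ :=
  GRing.Lmodule_isLalgebra.Build R crossed crossed_scalerAl.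

Lemma crossed_scalerAr (k : R) a b : k *: (a * b) = a * (k *: b).
Proof.
apply/ffunP => g; rewrite !ffunE scaler_sumr.
by apply: eq_bigr => h _; rewrite ffunE scalerAr /poly_act mpoly_linZ.
Qed.

HB.instance Definition _ :=
  GRing.Lalgebra_isAlgebra.Build R crossed crossed_scalerAr.

Definition crossed_poly (p : {mpoly R[n]}) : crossed :=
  [ffun g => if g == 1%g then p else 0].

Definition crossed_grp (h : gT) : crossed := [ffun g => (g == h)%:R].

Lemma crossed_polyM p q :
  crossed_poly (p * q) = crossed_poly p * crossed_poly q.
Proof.
apply/ffunP => g; rewrite !ffunE (bigD1 1%g) //= big1 => [|h h1].
  rewrite !ffunE eqxx invg1 mul1g poly_act1 addr0.
  by case: eqP => // _; rewrite mulr0.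
by rewrite ffunE (negbTE h1) mul0r.
Qed.

Lemma crossed_grpM g h : crossed_grp (g * h)%g = crossed_grp g * crossed_grp h.
Proof.
apply/ffunP => k; rewrite !ffunE (bigD1 g) //= big1 => [|l lg].
  by rewrite !ffunE eqxx mul1r poly_act_nat addr0 (can2_eq (mulKVg _) (mulKg _)).
by rewrite ffunE (negbTE lg) mul0r.
Qed.

Lemma crossed_grp_poly g p :
  crossed_grp g * crossed_poly p = crossed_poly (poly_act g p) * crossed_grp g.
Proof.
apply/ffunP => k; rewrite !ffunE (bigD1 g) //= big1 => [|l lg]; last first.
  by rewrite ffunE (negbTE lg) mul0r.
rewrite [RHS](bigD1 1%g) //= [X in _ = _ + X]big1 => [|l l1]; last first.
  by rewrite ffunE (negbTE l1) mul0r.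
rewrite !ffunE !eqxx invg1 mul1g poly_act_nat mul1r !addr0 -eq_mulVg1 eq_sym.
case: eqP => _; first by rewrite mulr1.
by rewrite mulr0 -(mpolyC0 n) [poly_act _ _]mpoly_lin_const mpolyC0.
Qed.

End CrossedProduct.

Section Hochschild.
Context {R : realType} {A : algType R}.
Implicit Types (m : A -> A -> A).

Definition hochschild_2cocycle m : Prop :=
  bilinear_for *:%R *:%R m /\
  forall a b c, a * m b c - m (a * b) c + m a (b * c) - m a b * c = 0.

Definition hochschild_2coboundary m : Prop :=
  exists2 phi : A -> A, linear phi &
    forall a b, m a b = a * phi b - phi (a * b) + phi a * b.

End Hochschild.

Section PowerSeries.

(* The series \sum_k u_k hbar^k is the sequence u, so nat -> R stands for
   R[[hbar]] and nat -> A for A[[hbar]]. *)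
Definition hseries (T : Type) := nat -> T.

Definition hconst {A : nmodType} (a : A) : hseries A :=
  fun k => if k == 0%N then a else 0.

Definition hadd {A : nmodType} (u v : hseries A) : hseries A :=
  fun k => u k + v k.

Definition hscale {R : pzRingType} {A : lmodType R}
    (c : hseries R) (u : hseries A) : hseries A :=
  fun k => \sum_(i < k.+1) c i *: u (k - i)%N.

Context {R : realType} {A : algType R}.

(* Every R[[hbar]]-bilinear product on A[[hbar]] is hbar-adically continuous,
   hence determined by the coefficients m_k a b of hbar^k in a * b, a b : A. *)
Definition star_coef (star : hseries A -> hseries A -> hseries A) (k : nat)
    (a b : A) : A :=
  star (hconst a) (hconst b) k.

Definition is_star_product (star : hseries A -> hseries A -> hseries A) :
    Prop :=
  [/\ forall (c : hseries R) u u' v,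
        star (hadd (hscale c u) u') v = hadd (hscale c (star u v)) (star u' v),
      forall (c : hseries R) u v v',
        star u (hadd (hscale c v) v') = hadd (hscale c (star u v)) (star u v'),
      forall u v w, star u (star v w) = star (star u v) w
    & forall a b, star_coef star 0 a b = a * b].

End PowerSeries.

Section Poisson.
Context {R : realType} {gT : finGroupType} {n : nat}.
Context (rG : mx_representation R [set: gT] n).
Context (ip : {dot 'cV[R]_n for idfun}).

Definition invariant_form : Prop :=
  forall (g : gT) (v w : 'cV[R]_n), ip (rG g *m v) (rG g *m w) = ip v w.

Definition fixv (g : gT) : {vspace 'cV[R]_n} :=
  fixedSpace (linfun (mulmx (rG g))).

Definition normv (g : gT) : {vspace 'cV[R]_n} := orthov ip (fixv g).

Definition codim (g : gT) : nat := \dim (normv g).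

Definition matrix_of_end (f : 'End('cV[R]_n)) : 'M[R]_n :=
  \matrix_(i, j) f (delta_mx j 0) i 0.

Definition proj_fix (g : gT) : 'M[R]_n :=
  matrix_of_end (daddv_pi (fixv g) (normv g)).

Definition proj_norm (g : gT) : 'M[R]_n :=
  matrix_of_end (daddv_pi (normv g) (fixv g)).

(* An element f of (a commutative ring) (x) wedge^2 V is the skew-symmetric
   matrix of its values f('X_i, 'X_j), where
   (v /\ w)(x, y) = x(v) y(w) - x(w) y(v). *)
Definition wedge (v w : 'cV[R]_n) : 'M[R]_n := v *m w^T - w *m v^T.

Definition in_wedge2 (U : {vspace 'cV[R]_n}) (W : 'M[R]_n) : Prop :=
  exists2 s : seq ('cV[R]_n * 'cV[R]_n),
    all (fun vw => (vw.1 \in U) && (vw.2 \in U)) s &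
    W = \sum_(vw <- s) wedge vw.1 vw.2.

(* Restriction of coefficients to V^g; the result is extended to V along N^g,
   i.e. S((V^g)^* ) is the subalgebra generated by the functionals vanishing on
   N^g. *)
Definition restrict_fix (g : gT) (F : 'M[{mpoly R[n]}]_n) :
    'M[{mpoly R[n]}]_n :=
  map_mx (mpoly_lin (proj_fix g)) F.

(* pr_g in degree 2.  According to l(g) = 0, 1, 2 the target is
   S((V^g)^* ) tensored with wedge^2 V^g, V^g (x) N^g (as v (x) w |-> v /\ w)
   or wedge^2 N^g; it is 0 if l(g) > 2. *)
Definition pr (g : gT) (F : 'M[{mpoly R[n]}]_n) : 'M[{mpoly R[n]}]_n :=
  let P := map_mx (@mpolyC n R) (proj_fix g) in
  let Q := map_mx (@mpolyC n R) (proj_norm g) in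
  let F' := restrict_fix g F in
  match codim g with
  | 0%N => P *m F' *m P^T
  | 1%N => P *m F' *m Q^T + Q *m F' *m P^T
  | 2%N => Q *m F' *m Q^T
  | _ => 0
  end.

Definition group_bilinear (m : crossed rG -> crossed rG -> crossed rG) : Prop :=
  forall (g : gT) (a b : crossed rG),
    [/\ m (crossed_grp rG g * a) b = crossed_grp rG g * m a b,
        m (a * crossed_grp rG g) b = m a (crossed_grp rG g * b)
      & m a (b * crossed_grp rG g) = m a b * crossed_grp rG g].

(* The bivector f_g, where m(x, y) - m(y, x) = \sum_g f_g(x, y) g. *)
Definition skew_part (m : crossed rG -> crossed rG -> crossed rG) (g : gT) :
    'M[{mpoly R[n]}]_n :=
  \matrix_(i, j) (m (crossed_poly rG 'X_i) (crossed_poly rG 'X_j)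
                  - m (crossed_poly rG 'X_j) (crossed_poly rG 'X_i)) g.

(* The class of m in H^2(A, A) is the family pi, under the identification of
   H^2(A, A) with invariant families given by a |-> (pr_g a_g)_g. *)
Definition has_class (m : crossed rG -> crossed rG -> crossed rG)
    (pi : gT -> 'M[{mpoly R[n]}]_n) : Prop :=
  exists m' : crossed rG -> crossed rG -> crossed rG,
    [/\ hochschild_2cocycle m',
        group_bilinear m',
        hochschild_2coboundary (fun a b => m a b - m' a b)
      & forall g, pr g (skew_part m' g) = pi g].

Definition quantizable (pi : gT -> 'M[{mpoly R[n]}]_n) : Prop :=
  exists2 star : hseries (crossed rG) -> hseries (crossed rG) ->
                 hseries (crossed rG),
    is_star_product star & has_class (star_coef star 1) pi.

(* The component at 1 is pi_0; l(1) = 0, so it does not interfere with the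
   components with l(g) = 2. *)
Definition constant_poisson (pi : gT -> 'M[R]_n) : Prop :=
  [/\ in_wedge2 fullv (pi 1%g),
      forall g, g != 1%g ->
        if codim g == 2%N then in_wedge2 (normv g) (pi g) else pi g = 0
    & forall g h : gT, pi (g * h * g^-1)%g = rG g *m pi h *m (rG g)^T].

Definition const_polyvector (pi : gT -> 'M[R]_n) (g : gT) :
    'M[{mpoly R[n]}]_n :=
  map_mx (@mpolyC n R) (pi g).

End Poisson.

(* Main.v *)
Require Import Defs.
From mathcomp Require Import all_boot all_order all_algebra all_fingroup.
From mathcomp Require Import mxrepresentation sesquilinear reals.
From mathcomp Require Import ssrcomplements mpoly boolp functions ring.
From HB Require Import structures.

Set Implicit Arguments.
Unset Strict Implicit.
Unset Printing Implicit Defensive.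

Import Order.TTheory GRing.Theory Num.Theory.

Local Open Scope ring_scope.

(** Constant Poisson structures are quantized by graded Hecke algebras: the
    algebra generated over R[[hbar]] by Gamma and the coordinates x_i, with
    [g x = (g . x) g] and
    [x_i x_j - x_j x_i = hbar * sum_g pi_g(x_i, x_j) g =: K_ij].
    What has to be shown is that this algebra is as large as A[[hbar]].  Here
    it is realised by R[[hbar]]-linear operators on A[[hbar]]: Gamma acts by
    left multiplication, and x_i acts by a deformation [X_i = x_i + D_i] of
    the left multiplication, with D_i divisible by hbar.

    The operators D_i are pinned down by asking for symmetric ordering.  Write
    d_j for the partial derivatives and Eu = sum_j x_j d_j for the Euler
    operator, which multiplies a homogeneous polynomial by its degree.
    Symmetric ordering means that sum_j X_j d_j = Eu, and then the commutation
    relation, multiplied on the right by d_j and summed over j, becomes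
      [D_i Eu + D_i = sum_j X_j D_i d_j + sum_j K_ij d_j],
    which is [deform_euler].  Each term on the right involves D_i either in
    lower degree or to lower order in hbar, so that the equation has exactly
    one solution.

    The same mechanism proves every identity below: an operator W with
      [W Eu + a W = sum_j C_j W d_j + (higher order in hbar)]
    is zero, by induction on the order in hbar and, within one order, on the
    degree ([hord_euler], [hop_euler_family]).  It gives the compatibility of
    the X_i with Gamma ([deform_twist]) and, through the Jacobi identity, the
    full relation X_i X_j - X_j X_i = K_ij ([defect_eq0]).  The Jacobi
    identity requires the cyclic sum of pi_g(x_j, x_l) (x_i - g x_i) to
    vanish; this holds since it is an alternating trilinear expression in
    vectors of N^g, which has dimension two ([constant_poisson_alt]).

    Symmetrization in the X_i then sends b in A[[hbar]] to the unique operator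
    Q_b that commutes with every X_i and every g and maps 1 to b
    ([symmetrize_unique]).  The product is [a star b = Q_b a].  Associativity
    says that Q_c Q_b = Q_(Q_c b), and both sides commute with the X_i and g
    and map 1 to Q_c b.  Because symmetrization respects Gamma on both sides,
    the first-order term of the product is itself an RGamma-bilinear cocycle,
    and its skew part is pi on the nose, so that no coboundary has to be
    subtracted. *)

(** * The Euler operator on polynomials *)

Section LinearExtension.
Context {R : comNzRingType} {n : nat} {M : lmodType R}.
Implicit Types (f : 'X_{1..n} -> M) (p q : {mpoly R[n]}).

Definition linext f p : M := \sum_(m <- msupp p) p@_m *: f m.

Lemma linextE f p k : (msize p <= k)%N ->
  linext f p = \sum_(m : 'X_{1..n < k}) p@_m *: f m.
Proof.
move=> le_pk; rewrite /linext (big_mksub 'X_{1..n < k}) ?msupp_uniq //=.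
  rewrite big_rmcond //= => m /memN_msupp_eq0 ->; exact: scale0r.
by move=> m /msize_mdeg_lt /leq_trans; apply.
Qed.

Lemma linext_is_linear f : linear (linext f).
Proof.
move=> a p q; pose k := maxn (msize (a *: p + q)) (maxn (msize p) (msize q)).
rewrite !(@linextE f _ k) ?leq_max ?leqnn ?orbT //.
rewrite scaler_sumr -big_split /=; apply: eq_bigr => m _.
by rewrite mcoeffD mcoeffZ scalerDl scalerA.
Qed.

HB.instance Definition _ f :=
  GRing.isLinear.Build R {mpoly R[n]} M *:%R (linext f) (linext_is_linear f).

Lemma linextX f m : linext f 'X_[m] = f m.
Proof. by rewrite /linext msuppX big_seq1 mcoeffX eqxx scale1r. Qed.

Lemma eq_linear_monomials (f g : {linear {mpoly R[n]} -> M}) :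
  (forall m, f 'X_[m] = g 'X_[m]) -> f =1 g.
Proof.
move=> fg p; rewrite [p]mpolyE !linear_sum; apply: eq_bigr => m _.
by rewrite !linearZ /= fg.
Qed.

End LinearExtension.

Section Euler.
Context {R : comNzRingType} {n : nat}.
Implicit Types (p : {mpoly R[n]}).

Definition euler p : {mpoly R[n]} := \sum_(i < n) 'X_i * p^`M(i).

Lemma euler_is_linear : linear euler.
Proof.
move=> a p q; rewrite /euler scaler_sumr -big_split /=; apply: eq_bigr => i _.
by rewrite linearP mulrDr scalerAr.
Qed.

HB.instance Definition _ :=
  GRing.isLinear.Build R {mpoly R[n]} {mpoly R[n]} *:%R euler euler_is_linear.

Lemma mulX_mderivX (i : 'I_n) m :
  'X_i * ('X_[m])^`M(i) = (m i)%:R *: 'X_[R, m].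
Proof.
rewrite mderivX -scalerAr -mpolyXD addmC.
have [-> | mi] := eqVneq (m i) 0%N; first by rewrite !scale0r.
by rewrite submK ?lep1mP.
Qed.

Lemma eulerX m : euler 'X_[m] = (mdeg m)%:R *: 'X_[R, m].
Proof.
rewrite /euler mdegE natr_sum scaler_suml.
apply: eq_bigr => i _; exact: mulX_mderivX.
Qed.

End Euler.

Lemma mdegB1 n (m : 'X_{1..n}) i : m i != 0%N -> (mdeg (m - U_(i))).+1 = mdeg m.
Proof. by move=> mi; rewrite -{2}(@submK _ U_(i) m) ?lep1mP // mdegD mdeg1 addn1. Qed.

Section EulerVanish.
Context {R : numFieldType} {n : nat} {M : lmodType R}.

(** On a monomial of degree k the left-hand side is (k + a) W, so that W is
    determined there by its values in degree k - 1; only k = a = 0 escapes. *)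
Lemma euler_vanish (W : {linear {mpoly R[n]} -> M}) (a : nat) :
    ((0 < a)%N \/ W 1 = 0) ->
    (forall p, (forall j, W p^`M(j) = 0) -> W (euler p) + W p *+ a = 0) ->
  forall p, W p = 0.
Proof.
move=> a_or W_step p.
suff WX m : W 'X_[m] = 0.
  rewrite [p]mpolyE linear_sum big1 // => m _.
  by rewrite linearZ /= WX scaler0.
have [k] := ubnP (mdeg m); elim: k m => // k IHk m lt_mk.
have [m0 | m_neq0] := eqVneq (mdeg m + a)%N 0%N.
  case: a_or => [a_gt0 | W1]; first by rewrite -(prednK a_gt0) addnS in m0.
  by move/eqP: m0; rewrite addn_eq0 mdeg_eq0 => /andP[/eqP -> _]; rewrite mpolyX0.
have := W_step 'X_[m]; rewrite eulerX linearZ /= -scaler_nat -scalerDl -natrD.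
move=> /(_ _)/eqP; rewrite scaler_eq0 pnatr_eq0 (negbTE m_neq0) => E.
apply/eqP/E => j; rewrite mderivX linearZ /=.
have [-> | mj] := eqVneq (m j) 0%N; first by rewrite scale0r.
by rewrite IHk ?scaler0 // -ltnS mdegB1.
Qed.

End EulerVanish.

Section Resolvent.
Context {R : comNzRingType} {n : nat} {M : lmodType R}.
Context (C : 'I_n -> {linear M -> M}) (c : nat -> R) (f : 'X_{1..n} -> M).

(** The solution of T = f + c(degree) sum_j C_j T d_j on monomials.  Derivatives
    lower the degree by one, so (degree + 1) steps of recursion suffice. *)
Fixpoint resolvent_rec (k : nat) (m : 'X_{1..n}) : M :=
  if k is k'.+1 then
    f m + c (mdeg m) *: \sum_j (m j)%:R *: C j (resolvent_rec k' (m - U_(j))%MM)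
  else 0.

Definition resolvent : {mpoly R[n]} -> M :=
  linext (fun m => resolvent_rec (mdeg m).+1 m).

HB.instance Definition _ := GRing.Linear.on resolvent.

Lemma resolventX m : resolvent 'X_[m] =
  f m + c (mdeg m) *: \sum_j C j (resolvent ('X_[m])^`M(j)).
Proof.
rewrite /resolvent linextX /=; congr (_ + _ *: _); apply: eq_bigr => j _.
rewrite mderivX !linearZ /= linextX.
have [-> | mj] := eqVneq (m j) 0%N; first by rewrite !scale0r.
by rewrite -{1}(mdegB1 mj).
Qed.

End Resolvent.

(** * Operators that are linear over the power series ring *)

Section HOperators.
Context {R : comNzRingType} {A : algType R}.
Implicit Types (u v : nat -> A) (a : A).

(** Multiplication by hbar. *)
Definition hshift u : nat -> A := fun k => if k is k'.+1 then u k' else 0.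

(** Commuting with hbar makes f linear over R[[hbar]] and not only over
    R[hbar]: a series divisible by a power of hbar goes to a series divisible
    by the same power, so f is continuous. *)
Definition hlinear (f : (nat -> A) -> (nat -> A)) : Prop :=
  linear f /\ forall u, f (hshift u) = hshift (f u).

Record hop := Hop { hop_fun :> (nat -> A) -> (nat -> A); hop_lin : hlinear hop_fun }.

HB.instance Definition _ (f : hop) :=
  GRing.isLinear.Build R (nat -> A) (nat -> A) *:%R (hop_fun f) (proj1 (hop_lin f)).

Lemma hop_shift (f : hop) u : f (hshift u) = hshift (f u).
Proof. exact: (proj2 (hop_lin f)). Qed.

Lemma hop_shift0 (f : hop) u : f (hshift u) 0%N = 0.
Proof. by rewrite hop_shift. Qed.

Lemma hop_shiftS (f : hop) u k : f (hshift u) k.+1 = f u k.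
Proof. by rewrite hop_shift. Qed.

Lemma hop_appD (f : hop) u v : f (u + v) = f u + f v. Proof. exact: linearD. Qed.
Lemma hop_app0 (f : hop) : f 0 = 0. Proof. exact: linear0. Qed.
Lemma hop_appZ (f : hop) c u : f (c *: u) = c *: f u. Proof. exact: linearZ. Qed.
Lemma hop_app_sum (f : hop) I (r : seq I) (P : pred I) (F : I -> nat -> A) :
  f (\sum_(i <- r | P i) F i) = \sum_(i <- r | P i) f (F i).
Proof. exact: linear_sum. Qed.

Lemma hopP (f g : hop) : f =1 g -> f = g.
Proof.
case: f g => [f Pf] [g Pg] /= /funext fg; rewrite -fg in Pg *.
by rewrite (Prop_irrelevance Pf Pg).
Qed.

HB.instance Definition _ := gen_eqMixin hop.
HB.instance Definition _ := gen_choiceMixin hop.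

Lemma hshift_is_linear : linear hshift.
Proof.
move=> a u v; apply/funext => -[|k] //=.
by rewrite [RHS]/= !fctE scaler0 addr0.
Qed.

HB.instance Definition _ :=
  GRing.isLinear.Build R (nat -> A) (nat -> A) *:%R hshift hshift_is_linear.

Fact hop_zero_lin : hlinear (fun=> 0).
Proof. by split=> [a u v|u]; rewrite ?linear0 ?scaler0 ?addr0. Qed.
Definition hop_zero := Hop hop_zero_lin.

Fact hop_add_lin (f g : hop) : hlinear (fun u => f u + g u).
Proof.
split=> [a u v|u]; first by rewrite !linearP addrACA scalerDr.
by rewrite !hop_shift linearD.
Qed.
Definition hop_add f g := Hop (hop_add_lin f g).

Fact hop_scale_lin (c : R) (f : hop) : hlinear (fun u => c *: f u).
Proof.
split=> [a u v|u]; first by rewrite linearP scalerDr !scalerA mulrC.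
by rewrite !hop_shift linearZ.
Qed.
Definition hop_scale c f := Hop (hop_scale_lin c f).

Fact hop_id_lin : hlinear id.
Proof. by []. Qed.
Definition hop_id := Hop hop_id_lin.

Fact hop_comp_lin (f g : hop) : hlinear (fun u => f (g u)).
Proof. by split=> [a u v|u]; rewrite ?linearP // !hop_shift. Qed.
Definition hop_comp f g := Hop (hop_comp_lin f g).

Fact hop_addA : associative hop_add.
Proof. move=> f g h; apply/hopP => u; exact: addrA. Qed.
Fact hop_addC : commutative hop_add.
Proof. move=> f g; apply/hopP => u; exact: addrC. Qed.
Fact hop_add0 : left_id hop_zero hop_add.
Proof. move=> f; apply/hopP => u; exact: add0r. Qed.
Fact hop_addN : left_inverse hop_zero (hop_scale (-1)) hop_add.
Proof. move=> f; apply/hopP => u /=; rewrite scaleN1r; exact: addNr. Qed.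

HB.instance Definition _ :=
  GRing.isZmodule.Build hop hop_addA hop_addC hop_add0 hop_addN.

Fact hop_compA : associative hop_comp.
Proof. by move=> f g h; apply/hopP. Qed.
Fact hop_comp1 : left_id hop_id hop_comp.
Proof. by move=> f; apply/hopP. Qed.
Fact hop_1comp : right_id hop_id hop_comp.
Proof. by move=> f; apply/hopP. Qed.
Fact hop_compDl : left_distributive hop_comp +%R.
Proof. by move=> f g h; apply/hopP. Qed.
Fact hop_compDr : right_distributive hop_comp +%R.
Proof. move=> f g h; apply/hopP => u; exact: linearD. Qed.
Fact hop_one_neq0 : hop_id != 0.
Proof.
apply/eqP => /(congr1 (fun f : hop => f (hconst (1 : A)) 0%N)) /= /eqP.
by rewrite /hconst /= oner_eq0.
Qed.

HB.instance Definition _ := GRing.Zmodule_isNzRing.Build hop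
  hop_compA hop_comp1 hop_1comp hop_compDl hop_compDr hop_one_neq0.

Fact hop_scaleA (a b : R) (f : hop) :
  hop_scale a (hop_scale b f) = hop_scale (a * b) f.
Proof. apply/hopP => u; exact: scalerA. Qed.
Fact hop_scale1 : left_id 1 hop_scale.
Proof. move=> f; apply/hopP => u; exact: scale1r. Qed.
Fact hop_scaleDr : right_distributive hop_scale +%R.
Proof. move=> c f g; apply/hopP => u; exact: scalerDr. Qed.
Fact hop_scaleDl (f : hop) : {morph hop_scale^~ f : a b / a + b}.
Proof. move=> a b; apply/hopP => u; exact: scalerDl. Qed.

HB.instance Definition _ := GRing.Zmodule_isLmodule.Build R hop
  hop_scaleA hop_scale1 hop_scaleDr hop_scaleDl.

Fact hop_scaleAl (k : R) (f g : hop) : k *: (f * g) = (k *: f) * g.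
Proof. exact: hopP. Qed.
HB.instance Definition _ := GRing.Lmodule_isLalgebra.Build R hop hop_scaleAl.
Fact hop_scaleAr (k : R) (f g : hop) : k *: (f * g) = f * (k *: g).
Proof.
by apply/hopP => u; rewrite -[LHS]/(k *: f (g u)) -linearZ.
Qed.
HB.instance Definition _ := GRing.Lalgebra_isAlgebra.Build R hop hop_scaleAr.

Lemma hopM (f g : hop) u : (f * g) u = f (g u). Proof. by []. Qed.
Lemma hop1 u : (1 : hop) u = u. Proof. by []. Qed.
Lemma hopD (f g : hop) u : (f + g) u = f u + g u. Proof. by []. Qed.
Lemma hop0 u : (0 : hop) u = 0. Proof. by []. Qed.
Lemma hopZ c (f : hop) u : (c *: f) u = c *: f u. Proof. by []. Qed.
Lemma hopN (f : hop) u : (- f) u = - f u. Proof. exact: scaleN1r. Qed.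
Lemma hopB (f g : hop) u : (f - g) u = f u - g u.
Proof. by rewrite hopD hopN. Qed.
Lemma hop_sum I (r : seq I) (P : pred I) (F : I -> hop) u :
  (\sum_(i <- r | P i) F i) u = \sum_(i <- r | P i) F i u.
Proof. by elim/big_rec2: _ => // i f v _ <-. Qed.
Lemma hopMn (f : hop) m u : (f *+ m) u = f u *+ m.
Proof. by elim: m => [//|m IHm]; rewrite !mulrS hopD IHm. Qed.

Definition hopE := (hop_sum, hopB, hopN, hopM, hop1, hopD, hop0, hopZ, hopMn).

Fact hshift_lin : hlinear hshift.
Proof. by split=> // a u v; rewrite linearP. Qed.
Definition hbar : hop := Hop hshift_lin.

Lemma hbarC (f : hop) : hbar * f = f * hbar.
Proof. by apply/hopP => u; rewrite !hopE hop_shift. Qed.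

Lemma hseries_split u : u = hconst (u 0%N) + hshift (fun k => u k.+1).
Proof. by apply/funext => -[|k]; rewrite !fctE /hconst /= ?addr0 ?add0r. Qed.

Lemma hconst_is_linear : linear (@hconst A).
Proof.
move=> c a b; apply/funext => -[|k] //; rewrite !fctE /hconst /=.
by rewrite scaler0 addr0.
Qed.

HB.instance Definition _ :=
  GRing.isLinear.Build R A (nat -> A) *:%R (@hconst A) hconst_is_linear.

(** The operators divisible by hbar^k. *)
Definition hord (k : nat) (f : hop) : Prop :=
  forall u i, (i < k)%N -> f u i = 0.

Lemma hord_const k (f : hop) :
  (forall a i, (i < k)%N -> f (hconst a) i = 0) -> hord k f.
Proof.
move=> f_const u i; elim: i u => [|i IHi] u lt_ik;
  rewrite {1}(hseries_split u) hop_appD hop_shift fctE f_const ?add0r //=.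
by apply: IHi; apply: ltnW.
Qed.

Lemma hop_const_inj (f g : hop) :
  (forall a, f (hconst a) = g (hconst a)) -> f = g.
Proof.
move=> fg; apply/hopP => u; apply/funext => i; apply/eqP; rewrite -subr_eq0.
have/(_ u i (ltnSn i)) : hord i.+1 (f - g).
  by apply: hord_const => a j _; rewrite hopB fg subrr.
by rewrite hopB => /eqP.
Qed.

Lemma hord_eq0 (f : hop) : (forall k, hord k f) -> f = 0.
Proof. by move=> f0; apply/hopP => u; apply/funext => i; apply: (f0 i.+1). Qed.

Lemma hord_zero k : hord k 0. Proof. by []. Qed.

Lemma hordD k f g : hord k f -> hord k g -> hord k (f + g).
Proof. by move=> f0 g0 u i ik; rewrite hopD fctE f0 ?g0 ?addr0. Qed.

Lemma hordN k f : hord k f -> hord k (- f).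
Proof. by move=> f0 u i ik; rewrite hopN fctE f0 ?oppr0. Qed.

Lemma hordB k f g : hord k f -> hord k g -> hord k (f - g).
Proof. by move=> f0 g0; apply/hordD/hordN. Qed.

Lemma hord_sum k I (r : seq I) (P : pred I) (F : I -> hop) :
  (forall i, P i -> hord k (F i)) -> hord k (\sum_(i <- r | P i) F i).
Proof. by move=> F0; elim/big_rec: _ => // i f Pi; apply: hordD; apply: F0. Qed.

Lemma hop_low (f : hop) k u :
  (forall i, (i < k)%N -> u i = 0) -> forall i, (i < k)%N -> f u i = 0.
Proof.
elim: k u => // k IHk u u0 i ik; rewrite (hseries_split u) u0 //.
rewrite linear0 add0r hop_shift; case: i ik => //= i ik.
by apply: IHk => // j jk; apply: u0.
Qed.

Lemma hordMr k f g : hord k f -> hord k (f * g).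
Proof. by move=> f0 u i ik; rewrite hopM f0. Qed.

Lemma hord_bar k f : hord k f -> hord k.+1 (hbar * f).
Proof. by move=> f0 u [|i] //= ik; apply: f0. Qed.

Lemma hop_low_ord (f : hop) k l u : hord l f ->
  (forall i, (i < k)%N -> u i = 0) -> forall i, (i < k + l)%N -> f u i = 0.
Proof.
move=> f0; elim: k u => [|k IHk] u u0 i ik; first exact: f0.
rewrite (hseries_split u) u0 // linear0 add0r hop_shift.
by case: i ik => //= i ik; apply: IHk => // j jk; apply: u0.
Qed.

Lemma hordM k l f g : hord l f -> hord k g -> hord (k + l) (f * g).
Proof. by move=> f0 g0 u; apply: hop_low_ord f0 _ => i; apply: g0. Qed.

Lemma hordW k l f : (l <= k)%N -> hord k f -> hord l f.
Proof. by move=> lk f0 u i il; apply/f0/(leq_trans il). Qed.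

(** The R[[hbar]]-linear operator with prescribed values on constant series. *)
Definition hext (F : A -> nat -> A) : (nat -> A) -> (nat -> A) :=
  fun u k => \sum_(i < k.+1) F (u i) (k - i)%N.

Lemma hext_lin (F : {linear A -> (nat -> A)}) : hlinear (hext F).
Proof.
split=> [a u v|u]; apply/funext => k; rewrite /hext.
  rewrite !fctE /= scaler_sumr -big_split /=; apply: eq_bigr => i _.
  by rewrite linearP.
case: k => [|k]; first by rewrite big_ord1 /= linear0.
by rewrite big_ord_recl /= linear0 add0r.
Qed.

Definition hop_ext (F : {linear A -> (nat -> A)}) : hop := Hop (hext_lin F).

Lemma hop_extE (F : {linear A -> (nat -> A)}) a : hop_ext F (hconst a) = F a.
Proof.
apply/funext => k; rewrite /= /hext big_ord_recl subn0 big1 ?addr0 //= => i _.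
by rewrite /hconst /= linear0.
Qed.

End HOperators.

Arguments hop {R} A.

(** * Operators on the crossed product *)

Lemma mderivXU (R : nzRingType) n (i j : 'I_n) :
  ('X_i : {mpoly R[n]})^`M(j) = (i == j)%:R.
Proof.
rewrite mderivX mnm1E; case: eqP => [->|_]; last by rewrite scale0r.
rewrite scale1r -mpolyX0; congr 'X_[_]; apply/mnmP => l.
by rewrite mnmBE subnn mnm0E.
Qed.

(** The basic operators below are sealed by this key: rewriting with ring
    identities must treat them as atoms and not look inside. *)
Fact operator_key : unit. Proof. by []. Qed.

Section CrossedOperators.
Context {R : realType} {gT : finGroupType} {n : nat}.
Context (rG : mx_representation R [set: gT] n).
Local Notation A := (crossed rG).
Local Notation hop := (hop A).
Implicit Types (g h : gT) (p q : {mpoly R[n]}) (a b : A).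

Definition crossed_mono g p : A := [ffun h => if h == g then p else 0].

Lemma crossed_mono_is_linear g : linear (crossed_mono g).
Proof.
move=> c p q; apply/ffunP => h; rewrite !ffunE.
by case: eqP => // _; rewrite scaler0 addr0.
Qed.

HB.instance Definition _ g := GRing.isLinear.Build R {mpoly R[n]} A *:%R
  (crossed_mono g) (crossed_mono_is_linear g).

Lemma crossed_monoE a : a = \sum_g crossed_mono g (a g).
Proof.
apply/ffunP => h; rewrite sum_ffunE (bigD1 h) //= big1 => [|g gh].
  by rewrite ffunE eqxx addr0.
by rewrite ffunE eq_sym (negbTE gh).
Qed.

Lemma crossed_mono_mul a g p h :
  (a * crossed_mono g p) h = a (h * g^-1)%g * poly_act rG (h * g^-1)%g p.
Proof.
rewrite [LHS]ffunE (bigD1 (h * g^-1)%g) //= big1 => [|k kh].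
  by rewrite ffunE invMg invgK mulgKV eqxx addr0.
rewrite ffunE ifN ?[poly_act _ _ _](linear0 (comp_mpoly _)) ?mulr0 //.
by apply: contraNneq kh => <-; rewrite invMg invgK mulKVg.
Qed.

Lemma crossed_mono_mulE g h p q :
  crossed_mono g p * crossed_mono h q =
  crossed_mono (g * h)%g (p * poly_act rG g q).
Proof.
apply/ffunP => k; rewrite crossed_mono_mul !ffunE.
rewrite (can2_eq (mulgKV _) (mulgK _)).
by case: eqP => [->|_]; rewrite ?mulgK ?mul0r.
Qed.

Lemma crossed_polyE p : crossed_poly rG p = crossed_mono 1%g p.
Proof. by []. Qed.

Lemma crossed_grpE g : crossed_grp rG g = crossed_mono g 1.
Proof. by apply/ffunP => h; rewrite !ffunE; case: eqP. Qed.

(** The constant series p g; operators are tested on these. *)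
Definition hmono g p : nat -> A := hconst (crossed_mono g p).

Lemma hord_mono k (f : hop) :
  (forall g p i, (i < k)%N -> f (hmono g p) i = 0) -> hord k f.
Proof.
move=> f0; apply: hord_const => a i ik.
rewrite [a]crossed_monoE linear_sum hop_app_sum fct_sumE big1 // => g _.
exact: f0.
Qed.

Lemma hop_mono_inj (f h : hop) :
  (forall g p, f (hmono g p) = h (hmono g p)) -> f = h.
Proof.
move=> fh; apply: hop_const_inj => a; rewrite [a]crossed_monoE linear_sum.
by rewrite !hop_app_sum; apply: eq_bigr => g _; apply: fh.
Qed.

Lemma hmap_lin (F : {linear A -> A}) : hlinear (fun u k => F (u k)).
Proof.
split=> [c u v|u]; apply/funext => k; first by rewrite !fctE linearP.
by case: k => //=; rewrite linear0.
Qed.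

Definition hmap (F : {linear A -> A}) : hop := Hop (hmap_lin F).

Lemma hmap_const F a : hmap F (hconst a) = hconst (F a).
Proof. by apply/funext => -[|k] //; rewrite /hconst /= linear0. Qed.

Definition lmul a : hop := hmap (a \*o idfun).

Definition rmul a : hop := hmap (a \o* idfun).

Definition hcoord i : hop :=
  locked_with operator_key (lmul (crossed_poly rG 'X_i)).

Lemma hcoordE i : hcoord i = lmul (crossed_poly rG 'X_i).
Proof. by rewrite /hcoord unlock. Qed.

Definition lgrp g : hop :=
  locked_with operator_key (lmul (crossed_grp rG g)).

Lemma lgrpE g : lgrp g = lmul (crossed_grp rG g).
Proof. by rewrite /lgrp unlock. Qed.

Definition rgrp g : hop :=
  locked_with operator_key (rmul (crossed_grp rG g)).

Lemma rgrpE g : rgrp g = rmul (crossed_grp rG g).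
Proof. by rewrite /rgrp unlock. Qed.

Definition crossed_deriv i a : A := [ffun g => (a g)^`M(i)].

Lemma crossed_deriv_is_linear i : linear (crossed_deriv i).
Proof. by move=> c a b; apply/ffunP => g; rewrite !ffunE linearP. Qed.

HB.instance Definition _ i := GRing.isLinear.Build R A A *:%R
  (crossed_deriv i) (crossed_deriv_is_linear i).

Definition hderiv i : hop :=
  locked_with operator_key (hmap (crossed_deriv i)).

Lemma hderivE i : hderiv i = hmap (crossed_deriv i).
Proof. by rewrite /hderiv unlock. Qed.

Definition eulerop : hop :=
  locked_with operator_key (\sum_(i < n) hcoord i * hderiv i).

Lemma euleropE : eulerop = \sum_(i < n) hcoord i * hderiv i.
Proof. by rewrite /eulerop unlock. Qed.

Lemma lmul_const a b : lmul a (hconst b) = hconst (a * b).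
Proof. exact: hmap_const. Qed.

Lemma rmul_const a b : rmul a (hconst b) = hconst (b * a).
Proof. exact: hmap_const. Qed.

Lemma hcoord_mono i g p : hcoord i (hmono g p) = hmono g ('X_i * p).
Proof.
rewrite hcoordE lmul_const crossed_polyE crossed_mono_mulE mul1g.
by rewrite poly_act1.
Qed.

Lemma lgrp_mono g h p : lgrp g (hmono h p) = hmono (g * h) (poly_act rG g p).
Proof. by rewrite lgrpE lmul_const crossed_grpE crossed_mono_mulE mul1r. Qed.

Lemma rgrp_mono g h p : rgrp g (hmono h p) = hmono (h * g) p.
Proof.
by rewrite rgrpE rmul_const crossed_grpE crossed_mono_mulE (poly_act_nat rG h 1) mulr1.
Qed.

Lemma hderiv_mono i g p : hderiv i (hmono g p) = hmono g p^`M(i).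
Proof.
rewrite hderivE hmap_const; congr hconst; apply/ffunP => h; rewrite !ffunE.
by case: eqP => // _; rewrite mderiv0.
Qed.

Lemma hmono_linear g : linear (hmono g).
Proof. by move=> c p q; rewrite /hmono !linearP. Qed.

HB.instance Definition _ g := GRing.isLinear.Build R {mpoly R[n]} (nat -> A)
  *:%R (hmono g) (hmono_linear g).

Lemma hmonoZ g c p : hmono g (c *: p) = c *: hmono g p.
Proof. exact: linearZ. Qed.

Lemma eulerop_mono g p : eulerop (hmono g p) = hmono g (euler p).
Proof.
rewrite euleropE hop_sum /euler linear_sum; apply: eq_bigr => i _.
by rewrite hopM hderiv_mono hcoord_mono.
Qed.

Lemma hderiv_coord i j : hderiv j * hcoord i = hcoord i * hderiv j + (i == j)%:R.
Proof.
apply: hop_mono_inj => g p; rewrite hopD !hopM hcoord_mono !hderiv_mono hcoord_mono.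
rewrite mderivM mderivXU addrC linearD /=; congr (_ + _).
by case: eqP => _; rewrite ?mul1r // mul0r linear0.
Qed.

Lemma hcoordC i j : hcoord i * hcoord j = hcoord j * hcoord i.
Proof. by apply: hop_mono_inj => g p; rewrite !hopM !hcoord_mono mulrCA. Qed.

Lemma hderivC i j : hderiv i * hderiv j = hderiv j * hderiv i.
Proof. by apply: hop_mono_inj => g p; rewrite !hopM !hderiv_mono mderiv_comm. Qed.

Lemma lgrpM g h : lgrp (g * h) = lgrp g * lgrp h.
Proof.
by apply: hop_mono_inj => k p; rewrite hopM !lgrp_mono mulgA poly_actM.
Qed.

Lemma lgrp1 : lgrp 1 = 1.
Proof. by apply: hop_mono_inj => k p; rewrite lgrp_mono mul1g poly_act1. Qed.

Lemma lmul_rmul a b : lmul a * rmul b = rmul b * lmul a.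
Proof. by apply/hopP => u; apply/funext => k /=; rewrite mulrA. Qed.

Lemma hderiv_rgrp i g : hderiv i * rgrp g = rgrp g * hderiv i.
Proof.
by apply: hop_mono_inj => k p; rewrite !hopM rgrp_mono !hderiv_mono rgrp_mono.
Qed.

Lemma lgrp_coord g i :
  lgrp g * hcoord i = \sum_j rG g^-1%g i j *: (hcoord j * lgrp g).
Proof.
apply: hop_mono_inj => k p.
rewrite hopM hcoord_mono lgrp_mono /poly_act mpoly_linM mpoly_linX hop_sum.
rewrite mulr_suml linear_sum; apply: eq_bigr => j _.
by rewrite hopZ hopM lgrp_mono hcoord_mono -scalerAl linearZ.
Qed.

End CrossedOperators.

Section ChainRule.
Context {R : realType} {n : nat}.

Lemma mpoly_alg_ind (P : {mpoly R[n]} -> Prop) :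
  (forall c, P c%:MP) -> (forall i, P 'X_i) ->
  (forall p q, P p -> P q -> P (p + q)) ->
  (forall p q, P p -> P q -> P (p * q)) -> forall p, P p.
Proof.
move=> PC PX PD PM p; rewrite [p]mpolyE.
apply: (big_ind P) => [|//|m _]; first by rewrite -(mpolyC0 n).
rewrite -mul_mpolyC; apply: (PM) => //; rewrite mpolyXE_id.
apply: (big_ind P) => [|//|i _]; first by rewrite -(mpolyC1 n).
elim: (m i) => [|k IHk]; first by rewrite expr0 -(mpolyC1 n).
by rewrite exprS; apply: PM.
Qed.

Lemma mderiv_lin (M : 'M[R]_n) l p :
  (mpoly_lin M p)^`M(l) = \sum_j M j l *: mpoly_lin M p^`M(j).
Proof.
elim/mpoly_alg_ind: p => [c|i|p q IHp IHq|p q IHp IHq].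
- rewrite mpoly_lin_const mderivC big1 // => j _.
  by rewrite mderivC -(mpolyC0 n) mpoly_lin_const mpolyC0 scaler0.
- rewrite mpoly_linX linear_sum (bigD1 l) //= [RHS](bigD1 i) //=.
  rewrite !big1 ?addr0 => [|j jl|j jl]; rewrite ?linearZ /= !mderivXU.
  + by rewrite !eqxx -(mpolyC1 n) mpoly_lin_const.
  + rewrite eq_sym (negbTE jl) -(mpolyC0 n) mpoly_lin_const mpolyC0.
    by rewrite scaler0.
  + by rewrite (negbTE jl) scaler0.
- rewrite mpoly_linD mderivD IHp IHq -big_split /=; apply: eq_bigr => j _.
  by rewrite mderivD mpoly_linD scalerDr.
- rewrite mpoly_linM mderivM IHp IHq mulr_suml mulr_sumr -big_split /=.
  apply: eq_bigr => j _.
  by rewrite mderivM mpoly_linD !mpoly_linM scalerDr -scalerAl -scalerAr.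
Qed.

End ChainRule.

(** * Solving and testing Euler equations *)

Section EulerEquation.
Context {R : realType} {gT : finGroupType} {n : nat}.
Context (rG : mx_representation R [set: gT] n).
Local Notation A := (crossed rG).
Local Notation hop := (hop A).
Local Notation d := (hderiv rG).
Local Notation x := (hcoord rG).
Local Notation L := (lgrp rG).
Local Notation Eu := (eulerop rG).

Lemma hderiv_lgrp l g : d l * L g = \sum_j rG g^-1%g j l *: (L g * d j).
Proof.
apply: hop_mono_inj => k p; rewrite hopM lgrp_mono hderiv_mono mderiv_lin.
rewrite hop_sum linear_sum; apply: eq_bigr => j _.
by rewrite hopZ hopM hderiv_mono lgrp_mono linearZ /=.
Qed.

Lemma eulerop_coord i : Eu * x i = x i * Eu + x i.
Proof.
rewrite euleropE mulr_suml mulr_sumr (eq_bigr (fun j => x i * (x j * d j) +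
  (i == j)%:R * x j)) => [|j _].
  rewrite big_split /=; congr (_ + _); rewrite (bigD1 i) //= eqxx mul1r.
  by rewrite big1 ?addr0 // => j; rewrite eq_sym => /negbTE ->; rewrite mul0r.
by rewrite -mulrA hderiv_coord mulrDr mulrA hcoordC -mulrA mulr_natr mulr_natl.
Qed.

Lemma hderiv_eulerop i : d i * Eu = Eu * d i + d i.
Proof.
rewrite euleropE mulr_suml mulr_sumr (eq_bigr (fun j => x j * d j * d i +
  (i == j)%:R * d j)) => [|j _].
  rewrite big_split /=; congr (_ + _); rewrite (bigD1 i) //= eqxx mul1r.
  by rewrite big1 ?addr0 // => j; rewrite eq_sym => /negbTE ->; rewrite mul0r.
by rewrite mulrA hderiv_coord mulrDl eq_sym -!mulrA hderivC.
Qed.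

Definition htrunc k (u : nat -> A) : nat -> A := fun i => if (i < k)%N then u i else 0.

Lemma htrunc_is_linear k : linear (htrunc k).
Proof.
move=> c u v; apply/funext => i; rewrite /htrunc !fctE.
by case: ifP; rewrite // scaler0 addr0.
Qed.

HB.instance Definition _ k := GRing.isLinear.Build R (nat -> A) (nat -> A)
  *:%R (htrunc k) (htrunc_is_linear k).

Lemma htruncP k u : htrunc k u = 0 <-> forall i, (i < k)%N -> u i = 0.
Proof.
split=> [u0 i ik|u0]; last by apply/funext => i; rewrite /htrunc; case: ifP => // /u0.
by have /(congr1 (@^~ i)) := u0; rewrite /htrunc ik.
Qed.

(** The uniqueness principle behind all operator identities: modulo hbar^k the
    equation reduces, on each summand S g of A, to the one of
    [euler_vanish]. *)
Lemma hord_euler k a (W r : hop) (C : 'I_n -> hop) :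
    W * Eu + W *+ a = \sum_j C j * W * d j + r -> hord k r ->
    ((0 < a)%N \/ forall g i, (i < k)%N -> W (hmono rG g 1) i = 0) ->
  hord k W.
Proof.
move=> W_eq r0 a_or; apply: hord_mono => g p.
apply/htruncP.
pose F := (htrunc k \o (hop_fun W \o hmono rG g)) : {linear _ -> _}.
rewrite -[LHS]/(F p); apply: (euler_vanish (a := a)) => [|q dq0].
  by case: a_or => [|W1]; [left | right; apply/htruncP => i; apply: W1].
have := congr1 (fun f : hop => htrunc k (f (hmono rG g q))) W_eq.
rewrite !hopE eulerop_mono [LHS]linearD linearMn /= => ->.
apply/htruncP => i ik; rewrite fctE r0 // addr0 fct_sumE big1 // => j _.
rewrite hderiv_mono; apply: hop_low ik => l lk.
by have /htruncP := dq0 j; apply.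
Qed.

Lemma hop_euler0 a (W : hop) (C : 'I_n -> hop) :
    W * Eu + W *+ a = \sum_j C j * W * d j ->
    ((0 < a)%N \/ forall g, W (hmono rG g 1) = 0) ->
  W = 0.
Proof.
move=> W_eq a_or; apply: hord_eq0 => k.
apply: (@hord_euler k a W 0 C) => //; first by rewrite addr0.
by case: a_or => [|W1]; [left | right => g i _; rewrite W1].
Qed.

(** Induction on the order in hbar for a family of operators whose equations
    are coupled only through terms of higher order. *)
Lemma hop_euler_family (I : Type) a (W r : I -> hop) (C : 'I_n -> hop) :
    (0 < a)%N ->
    (forall i, W i * Eu + W i *+ a = \sum_j C j * W i * d j + r i) ->
    (forall k, (forall i, hord k (W i)) -> forall i, hord k.+1 (r i)) ->
  forall i, W i = 0.
Proof.
move=> a_gt0 W_eq r_ord i; apply: hord_eq0 => k.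
elim: k i => // k IHk i; apply: (hord_euler (W_eq i)); last by left.
exact: r_ord.
Qed.

Section Solve.
Context (C : 'I_n -> hop) (c : nat -> R) (f : gT -> 'X_{1..n} -> (nat -> A)).

Definition solve_coef (a : A) : nat -> A :=
  \sum_g resolvent (fun j => hop_fun (C j)) c (f g) (a g).

Lemma solve_coef_is_linear : linear solve_coef.
Proof.
move=> k a b; rewrite /solve_coef scaler_sumr -big_split /=.
by apply: eq_bigr => g _; rewrite !ffunE linearP.
Qed.

HB.instance Definition _ :=
  GRing.isLinear.Build R A (nat -> A) *:%R solve_coef solve_coef_is_linear.

Definition solve : hop := hop_ext solve_coef.

Lemma solve_mono g p :
  solve (hmono rG g p) = resolvent (fun j => hop_fun (C j)) c (f g) p.
Proof.
rewrite /solve /hmono hop_extE /= /solve_coef (bigD1 g) //= ffunE eqxx big1 ?addr0 //.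
by move=> h hg; rewrite ffunE (negbTE hg) linear0.
Qed.

Lemma solveX g m : solve (hmono rG g 'X_[m]) = f g m +
  c (mdeg m) *: (\sum_j C j * solve * d j) (hmono rG g 'X_[m]).
Proof.
rewrite solve_mono resolventX hop_sum; congr (_ + _ *: _).
by apply: eq_bigr => j _; rewrite !hopM hderiv_mono solve_mono.
Qed.

End Solve.

Lemma hop_monoX_inj (f h : hop) :
  (forall g m, f (hmono rG g 'X_[m]) = h (hmono rG g 'X_[m])) -> f = h.
Proof.
move=> fh; apply: hop_mono_inj => g p.
pose F (f : hop) := (hop_fun f \o hmono rG g) : {linear _ -> _}.
by rewrite -[LHS]/(F f p) -[RHS]/(F h p); apply: eq_linear_monomials => m; apply: fh.
Qed.

(** On degree k the left-hand side is (k + 1) T, which can be divided. *)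
Fact solve1_exists C (G : hop) :
  {T : hop | T * Eu + T = \sum_j C j * T * d j + G}.
Proof.
pose f g m := (mdeg m).+1%:R^-1 *: G (hmono rG g 'X_[m]).
exists (solve C (fun k => k.+1%:R^-1) f).
have := solveX C (fun k => k.+1%:R^-1) f; move: (solve _ _ _) => T TX.
apply: hop_monoX_inj => g m; rewrite !hopD hopM eulerop_mono eulerX hmonoZ.
rewrite hop_appZ -{2}[T _]scale1r -scalerDl natr1.
rewrite [X in _ *: X = _]TX scalerDr !scalerA.
by rewrite mulfV ?pnatr_eq0 // !scale1r addrC.
Qed.

Definition solve1 C G : hop := sval (solve1_exists C G).

Lemma solve1E C G :
  solve1 C G * Eu + solve1 C G = \sum_j C j * solve1 C G * d j + G.
Proof. exact: (svalP (solve1_exists C G)). Qed.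

(** The equation leaves the degree zero part of T free, and its value on the
    group element g can be prescribed.  The inverse of 0 is 0, which makes the
    recursion ignore the sum there. *)
Fact solve0_exists C (b : gT -> nat -> A) :
  {T : hop | T * Eu = \sum_j C j * T * d j
           & forall g, T (hmono rG g 1) = b g}.
Proof.
pose f g (m : 'X_{1..n}) := if m == 0%MM then b g else 0.
exists (solve C (fun k => k%:R^-1) f);
  have := solveX C (fun k => k%:R^-1) f; move: (solve _ _ _) => T TX; last first.
  by move=> g; rewrite -mpolyX0 TX /f eqxx mdeg0 invr0 scale0r addr0.
apply: hop_monoX_inj => g m; rewrite hopM eulerop_mono eulerX hmonoZ.
rewrite hop_appZ; have [-> | m_neq0] := eqVneq m 0%MM.
  rewrite mdeg0 scale0r hop_sum big1 // => j _.
  by rewrite !hopM hderiv_mono mpolyX0 -(mpolyC1 n) mderivC linear0 !hop_app0.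
rewrite [in LHS]TX /f (negbTE m_neq0) add0r scalerA.
by rewrite mulfV ?scale1r // pnatr_eq0 mdeg_eq0.
Qed.

Definition solve0 C b : hop := s2val (solve0_exists C b).

Lemma solve0E C b : solve0 C b * Eu = \sum_j C j * solve0 C b * d j.
Proof. exact: (s2valP (solve0_exists C b)). Qed.

Lemma solve0_1 C b g : solve0 C b (hmono rG g 1) = b g.
Proof. exact: (s2valP' (solve0_exists C b)). Qed.

End EulerEquation.

(** * The deformed coordinates *)

Section Deformation.
Context {R : realType} {gT : finGroupType} {n : nat}.
Context (rG : mx_representation R [set: gT] n).
Local Notation A := (crossed rG).
Local Notation hop := (hop A).
Local Notation d := (hderiv rG).
Local Notation x := (hcoord rG).
Local Notation Eu := (eulerop rG).

Lemma hop_coefP (f g : hop) :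
  (forall u k h, f u k h = g u k h) -> f = g.
Proof. by move=> fg; apply/hopP => u; apply/funext => k; apply/ffunP => h. Qed.

Lemma hop_coefD (f g : hop) u k h : (f + g) u k h = f u k h + g u k h.
Proof. by rewrite hopD ffunE. Qed.

Lemma hop_coefN (f : hop) u k h : (- f) u k h = - f u k h.
Proof. by rewrite hopN ffunE. Qed.

Lemma hop_coef0 u k h : (0 : hop) u k h = 0.
Proof. by rewrite hop0 ffunE. Qed.

Lemma hop_skew0 (S : hop) : S = - S -> S = 0.
Proof.
move=> S_skew; apply/eqP.
have /eqP: S *+ 2 = 0 by rewrite mulr2n {2}S_skew subrr.
by rewrite -scaler_nat scaler_eq0 pnatr_eq0.
Qed.

Lemma hderiv1 i g : d i (hmono rG g 1) = 0.
Proof. by rewrite hderiv_mono -(mpolyC1 n) mderivC linear0. Qed.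

Lemma solve1_hord k (C : 'I_n -> hop) (G G' : hop) :
  hord k (G - G') -> hord k (solve1 C G - solve1 C G').
Proof.
move=> G_ord; move: (solve1 C G) (solve1 C G') (solve1E C G) (solve1E C G').
move=> S S' SE SE'.
apply: (@hord_euler _ _ _ _ k 1 _ (G - G') C) => //; last by left.
rewrite mulr1n mulrBl addrACA -opprD SE SE' opprD addrACA -sumrB.
congr (_ + _); apply: eq_bigr => j _.
by rewrite mulrBr mulrBl.
Qed.

Context (K : 'I_n -> 'I_n -> hop).

(** Moving the summand x_j D_i d_j of the Euler equation for D to the solved
    side leaves a right-hand side that is quadratic in D, hence contracting in
    the hbar-adic topology. *)
Definition deform_rhs (D : 'I_n -> hop) i : hop :=
  \sum_j D j * D i * d j + \sum_j K i j * d j.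

Fixpoint deform_rec (N : nat) : 'I_n -> hop :=
  if N is N'.+1 then fun i => solve1 x (deform_rhs (deform_rec N') i)
  else fun=> 0.

Lemma deform_rhs_hord k (D D' : 'I_n -> hop) :
    (forall i, hord 1 (D i)) -> (forall i, hord 1 (D' i)) ->
    (forall i, hord k (D i - D' i)) ->
  forall i, hord k.+1 (deform_rhs D i - deform_rhs D' i).
Proof.
move=> D1 D1' DD' i; rewrite /deform_rhs opprD addrACA subrr addr0 -sumrB.
apply: hord_sum => j _; rewrite -mulrBl; apply: hordMr.
have -> : D j * D i - D' j * D' i = (D j - D' j) * D i + D' j * (D i - D' i).
  by rewrite mulrBl mulrBr addrA subrK.
by rewrite -add1n; apply: hordD; [rewrite add1n -addn1 addnC|rewrite addnC]; apply: hordM.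
Qed.

Hypothesis K_ord : forall i j, hord 1 (K i j).

Lemma deform_rec_hord1 N i : hord 1 (deform_rec N i).
Proof.
elim: N i => [|N IHN] i; first exact: hord_zero.
have := @solve1_hord 1 x (deform_rhs (deform_rec N) i) 0.
have -> : solve1 x 0 = 0 :> hop.
  apply: (@hop_euler0 _ _ _ _ 1 _ x); last by left.
  by rewrite mulr1n solve1E addr0.
rewrite !subr0; apply; apply: hordD; apply: hord_sum => j _; apply: hordMr => //.
exact: hordMr.
Qed.

Lemma deform_rec_stable N M i : (N <= M)%N ->
  hord N (deform_rec M i - deform_rec N i).
Proof.
elim: N M i => [//|N IHN] [//|M] i NM /=.
by apply/solve1_hord/deform_rhs_hord => *; apply: deform_rec_hord1 || apply: IHN.
Qed.

(** The hbar-adic limit: the coefficient of hbar^k is final after k + 1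
    iterations. *)
Definition deform_fun i (u : nat -> A) : nat -> A :=
  fun k => deform_rec k.+1 i u k.

Lemma deform_rec_eq N M i u k : (k < N)%N -> (k < M)%N ->
  deform_rec M i u k = deform_rec N i u k.
Proof.
wlog le_NM : N M / (N <= M)%N.
  by move=> wlogNM; case: (leqP N M) => [|/ltnW] NM *; [|symmetry]; apply: wlogNM.
move=> kN _; apply/eqP; rewrite -subr_eq0.
by have := deform_rec_stable i le_NM u kN; rewrite hopB => /eqP.
Qed.

Fact deform_lin i : hlinear (deform_fun i).
Proof.
split=> [c u v|u]; apply/funext => k.
  rewrite -[RHS]/(c *: deform_rec k.+1 i u k + deform_rec k.+1 i v k).
  by rewrite /deform_fun; move: (deform_rec _ i) => f; rewrite hop_appD hop_appZ.
rewrite /deform_fun; case: k => [|k]; first by rewrite hop_shift0.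
rewrite hop_shiftS -[RHS]/(deform_rec k.+1 i u k).
by apply: deform_rec_eq.
Qed.

Definition deform i : hop := locked_with operator_key (Hop (deform_lin i)).

Local Notation D := deform.
Local Notation X := (fun i => x i + D i).

Lemma deform_approx N i : hord N (D i - deform_rec N i).
Proof.
move=> u k kN; rewrite /deform unlock hopB; apply/eqP; rewrite subr_eq0.
by apply/eqP/deform_rec_eq.
Qed.

Lemma deform_hord1 i : hord 1 (D i).
Proof.
rewrite -[D i](subrK (deform_rec 1 i)).
by apply: hordD; [apply: deform_approx | apply: deform_rec_hord1].
Qed.

Lemma deform_fix i : D i = solve1 x (deform_rhs D i).
Proof.
apply/eqP; rewrite -subr_eq0; apply/eqP/hord_eq0 => k.
rewrite -(subrKA (deform_rec k.+1 i)); apply: hordD.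
  exact/(hordW (leqnSn k))/deform_approx.
apply: (hordW (leqnSn k)); rewrite -opprB; apply/hordN/solve1_hord.
by apply: deform_rhs_hord => *;
  [apply: deform_hord1 | apply: deform_rec_hord1 | apply: deform_approx].
Qed.

(** The contraction of the commutation relation with the derivatives, in terms
    of the deformation terms only. *)
Lemma deform_euler i :
  D i * Eu + D i = \sum_j X j * D i * d j + \sum_j K i j * d j.
Proof.
rewrite {1 2}deform_fix solve1E -deform_fix addrA -big_split /=; congr (_ + _).
by apply: eq_bigr => j _; rewrite !mulrDl.
Qed.

Lemma deform1 i g : D i (hmono rG g 1) = 0.
Proof.
have := congr1 (fun f : hop => f (hmono rG g 1)) (deform_euler i).
rewrite !hopD !hopM eulerop_mono -mpolyX0 eulerX mdeg0 scale0r linear0 hop_app0 add0r => ->.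
rewrite !hop_sum !big1 ?addr0 // => j _; rewrite !hopM mpolyX0 hderiv1 !hop_app0 //.
Qed.

Hypothesis K_skew : forall i j, K i j = - K j i.

Lemma skew_deriv0 : \sum_i (\sum_j K i j * d j) * d i = 0.
Proof.
apply: hop_skew0; rewrite -sumrN.
under [RHS]eq_bigr do rewrite -mulNr -sumrN mulr_suml.
under [LHS]eq_bigr do rewrite mulr_suml.
rewrite exchange_big; apply: eq_bigr => i _; apply: eq_bigr => j _.
by rewrite K_skew !mulNr -!mulrA hderivC.
Qed.

(** Symmetric ordering: contracting the Euler equation with d_i kills the term
    in K, which is skew, against the symmetric d_j d_i. *)
Lemma deform_deriv0 : \sum_i D i * d i = 0.
Proof.
apply: (@hop_euler0 _ _ _ _ 0 _ X) => /=; last first.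
  by right => g; rewrite hop_sum big1 // => i _; rewrite hopM hderiv1 hop_app0.
rewrite mulr0n addr0 mulr_suml.
under [LHS]eq_bigr do rewrite -mulrA hderiv_eulerop mulrDr mulrA -mulrDl deform_euler mulrDl.
rewrite big_split /= skew_deriv0 addr0.
under [LHS]eq_bigr do rewrite mulr_suml.
rewrite exchange_big; apply: eq_bigr => j _.
rewrite mulr_sumr mulr_suml; apply: eq_bigr => i _.
by rewrite -!mulrA hderivC.
Qed.

Lemma coord_deform_deriv : \sum_i X i * d i = Eu.
Proof.
under eq_bigr do rewrite mulrDl.
by rewrite big_split /= deform_deriv0 addr0 euleropE.
Qed.

(** An operator T that transforms the coordinates by a matrix rho, and the
    derivatives and K accordingly, transforms the deformed coordinates by rho
    as well: both sides solve the same Euler equation.  This applies to left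
    multiplication by a group element and, with rho = 1, to right
    multiplication. *)
Section Equivariance.
Context (T : hop) (rho : 'M[R]_n).
Hypothesis T_coord : forall i, T * x i = \sum_j rho i j *: (x j * T).
Hypothesis deriv_T : forall l, d l * T = \sum_j rho j l *: (T * d j).
Hypothesis T_K : forall i j,
  T * K i j = (\sum_l rho j l *: \sum_m rho i m *: K m l) * T.

Let tw (F : 'I_n -> hop) i := \sum_j rho i j *: F j.

Lemma sum_deriv_twist (Y : 'I_n -> hop) :
  (\sum_l Y l * d l) * T = \sum_j tw Y j * T * d j.
Proof.
rewrite mulr_suml.
under eq_bigr do rewrite -mulrA deriv_T mulr_sumr.
rewrite exchange_big; apply: eq_bigr => j _; rewrite !mulr_suml.
by apply: eq_bigr => l _; rewrite -scalerAr -!scalerAl mulrA.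
Qed.

Lemma twist_coord i : T * x i = tw x i * T.
Proof. by rewrite T_coord mulr_suml; apply: eq_bigr => j _; rewrite scalerAl. Qed.

Lemma eulerop_twist : Eu * T = T * Eu.
Proof.
rewrite euleropE sum_deriv_twist mulr_sumr; apply: eq_bigr => j _.
by rewrite -twist_coord mulrA.
Qed.

Let twD F G i : tw (fun j => F j + G j) i = tw F i + tw G i.
Proof. by rewrite -big_split; apply: eq_bigr => j _; rewrite scalerDr. Qed.

Let tw_mulr F (Z : hop) i : tw (fun j => F j * Z) i = tw F i * Z.
Proof. by rewrite mulr_suml; apply: eq_bigr => j _; rewrite scalerAl. Qed.

Let tw_sum (Y : 'I_n -> 'I_n -> hop) i :
  tw (fun m => \sum_l Y m l * d l) i = \sum_l tw (Y^~ l) i * d l.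
Proof.
rewrite /tw; under eq_bigr do rewrite scaler_sumr.
rewrite exchange_big; apply: eq_bigr => l _; rewrite mulr_suml.
by apply: eq_bigr => m _; rewrite scalerAl.
Qed.

Lemma deform_twist i : T * D i = tw D i * T.
Proof.
pose W i := T * D i - tw D i * T.
suff /(_ i)/eqP : forall i, W i = 0 by rewrite subr_eq0 => /eqP.
have TX j : T * X j = tw X j * T + W j.
  rewrite mulrDr twist_coord twD mulrDl -addrA; congr (_ + _).
  by rewrite addrC subrK.
have twXD l i' : tw (fun m => X l * D m) i' = X l * tw D i'.
  by rewrite mulr_sumr; apply: eq_bigr => m _; rewrite scalerAr.
have twDT i' : tw D i' * T * Eu + tw D i' * T =
    \sum_j tw X j * tw D i' * T * d j + T * \sum_j K i' j * d j.
  rewrite -mulrA -eulerop_twist mulrA -mulrDl -tw_mulr -twD.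
  under [tw _ _]eq_bigr do rewrite deform_euler.
  rewrite -/(tw (fun j => \sum_l X l * D j * d l + \sum_l K j l * d l) i').
  rewrite twD !tw_sum mulrDl !sum_deriv_twist; congr (_ + _).
    apply: eq_bigr => j _; rewrite -[tw X j * _]tw_mulr; congr (_ * T * _).
    by apply: eq_bigr => l _; rewrite twXD.
  rewrite mulr_sumr; by apply: eq_bigr => j _; rewrite mulrA T_K.
apply: (@hop_euler_family _ _ _ _ _ 1 W (fun i' => \sum_j W j * D i' * d j)
   (tw X)) => // [i'|k W0 i']; last first.
  apply: hord_sum => j _; apply: hordMr; rewrite -add1n.
  exact: (hordM (W0 j) (deform_hord1 i')).
rewrite mulr1n mulrBl addrACA -opprD -[T * D i' * Eu]mulrA -mulrDr.
rewrite deform_euler twDT mulrDr opprD addrACA subrr addr0.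
rewrite mulr_sumr -sumrB -big_split; apply: eq_bigr => j _ /=.
rewrite !mulrA TX -!mulrBl -mulrDl; congr (_ * _).
by rewrite mulrDl mulrBr -!mulrA addrAC.
Qed.

Lemma deform_coord_twist i : T * X i = tw X i * T.
Proof. by rewrite mulrDr twist_coord deform_twist twD mulrDl. Qed.

End Equivariance.
End Deformation.

(** * Commutation relations of the deformed coordinates *)

(** Identities between sums of operators, with products as atoms, become
    identities between polynomials once evaluated, where [ring] applies. *)
Ltac hop_abel :=
  apply: hop_coefP => ? ? ?;
  rewrite !(hop_coefD, hop_coefN, hop_coef0); ring.

Section Commutation.
Context {R : realType} {gT : finGroupType} {n : nat}.
Context (rG : mx_representation R [set: gT] n).
Local Notation A := (crossed rG).
Local Notation hop := (hop A).
Local Notation d := (hderiv rG).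
Local Notation x := (hcoord rG).
Local Notation Eu := (eulerop rG).
Context (K : 'I_n -> 'I_n -> hop).
Hypothesis K_ord : forall i j, hord 1 (K i j).
Hypothesis K_skew : forall i j, K i j = - K j i.
Local Notation D := (deform K_ord).

Definition dcoord i : hop := locked_with operator_key (x i + D i).

Lemma dcoordE i : dcoord i = x i + D i.
Proof. by rewrite /dcoord unlock. Qed.

Local Notation X := dcoord.

Lemma dcoord_deriv : \sum_i X i * d i = Eu.
Proof. by under eq_bigr do rewrite dcoordE; apply: coord_deform_deriv. Qed.

(** Normal ordering: x_i d_j = d_j x_i - delta_ij. *)
Lemma sum_coord_deriv (Y : 'I_n -> hop) i :
  \sum_j Y j * x i * d j = (\sum_j Y j * d j) * x i - Y i.
Proof.
rewrite mulr_suml; under [in RHS]eq_bigr do rewrite -mulrA hderiv_coord mulrDr.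
rewrite big_split /= [X in _ + X - _](bigD1 i) //= eqxx mulr1.
rewrite [X in Y i + X]big1 => [|j ji].
  by rewrite addr0 addrK; apply: eq_bigr => j _; rewrite mulrA.
by rewrite eq_sym (negbTE ji) mulr0.
Qed.

(** How far the deformed coordinates are from their commutation relation. *)
Definition defect i j : hop := X i * X j - X j * X i - K i j.
Local Notation Z := defect.

Lemma defect_skew i j : Z i j = - Z j i.
Proof. rewrite /defect K_skew; hop_abel. Qed.

(** This contraction of the relation is what the Euler equation encodes. *)
Lemma defect_deriv0 i : \sum_j Z i j * d j = 0.
Proof.
have -> : \sum_j Z i j * d j = X i * (\sum_j X j * d j)
    - (\sum_j X j * x i * d j + \sum_j X j * D i * d j) - \sum_j K i j * d j.
  rewrite mulr_sumr -big_split -!sumrB; apply: eq_bigr => j _ /=.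
  by rewrite -mulrDl -mulrDr -dcoordE !mulrBl !mulrA.
rewrite sum_coord_deriv dcoord_deriv eulerop_coord [X i * _](_ : _ = x i * Eu + D i * Eu); last by rewrite dcoordE mulrDl.
have -> : D i * Eu = \sum_j X j * D i * d j + \sum_j K i j * d j - D i.
  by under eq_bigr do rewrite dcoordE; rewrite -deform_euler addrK.
rewrite dcoordE; move: (\sum_j _) (\sum_j _) => S S'; hop_abel.
Qed.

Hypothesis jacobi : forall i j l, (X i * K j l - K j l * X i) +
  (X j * K l i - K l i * X j) + (X l * K i j - K i j * X l) = 0.

Lemma defect_jacobi i j l : (X i * Z j l - Z j l * X i) +
  (X j * Z l i - Z l i * X j) + (X l * Z i j - Z i j * X l) = 0.
Proof.
have := jacobi i j l; rewrite /defect.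
move: (X i) (X j) (X l) (K i j) (K j l) (K l i) => a b c k1 k2 k3.
move=> jac; rewrite -[RHS]oppr0 -{}jac.
rewrite !(mulrBl, mulrBr) !mulrA; hop_abel.
Qed.

Lemma sum_defect_deform i j : \sum_l Z i l * X j * d l =
  Z j i + \sum_l Z i l * D j * d l.
Proof.
under eq_bigr do rewrite dcoordE mulrDr mulrDl.
rewrite big_split /= sum_coord_deriv defect_deriv0 mul0r sub0r.
by rewrite -defect_skew.
Qed.

(** Contract the Jacobi identity for the defect with d_l.  The sums in which
    the defect meets d_l vanish; the two in which X_i or X_j stands between
    them are normal ordered and contribute the term 2 Z_ij. *)
Lemma defect_euler i j : Z i j * Eu + Z i j *+ 2 = \sum_l X l * Z i j * d l +
  \sum_l (Z i l * D j - Z j l * D i) * d l.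
Proof.
have : \sum_l ((X i * Z j l - Z j l * X i) + (X j * Z l i - Z l i * X j) +
               (X l * Z i j - Z i j * X l)) * d l = 0.
  by apply: big1 => l _; rewrite defect_jacobi mul0r.
have -> : \sum_l ((X i * Z j l - Z j l * X i) + (X j * Z l i - Z l i * X j) +
   (X l * Z i j - Z i j * X l)) * d l =
  X i * (\sum_l Z j l * d l) - \sum_l Z j l * X i * d l
  - X j * (\sum_l Z i l * d l) + \sum_l Z i l * X j * d l
  + \sum_l X l * Z i j * d l - Z i j * (\sum_l X l * d l).
  rewrite !mulr_sumr -!(sumrB, big_split) /=; apply: eq_bigr => l _.
  rewrite (defect_skew l i).
  move: (X i) (X j) (X l) (Z i l) (Z j l) (Z i j) (d l) => a b c k1 k2 k3 e.
  rewrite !(mulrDl, mulrBl, mulNr, mulrN) !mulrA; hop_abel.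
rewrite (defect_deriv0 i) (defect_deriv0 j) (mulr0 (X i)) (mulr0 (X j)).
rewrite (sum_defect_deform i j) (sum_defect_deform j i) dcoord_deriv.
rewrite (defect_skew j i).
have -> : \sum_l (Z i l * D j - Z j l * D i) * d l =
    \sum_l Z i l * D j * d l - \sum_l Z j l * D i * d l.
  by rewrite -sumrB; apply: eq_bigr => l _; rewrite mulrBl.
set S1 := \sum_l X l * _ * _; set S2 := \sum_l Z i l * _ * _.
set S3 := \sum_l Z j l * _ * _; set z' := Z i j * Eu.
move: (Z i j) S1 S2 S3 z' => z S1 S2 S3 z' E.
apply/eqP; rewrite -subr_eq0 -oppr_eq0 -[X in _ == X]E mulr2n; apply/eqP.
hop_abel.
Qed.

Lemma defect_eq0 i j : Z i j = 0.
Proof.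
apply: (@hop_euler_family _ _ _ _ _ 2 (fun ij => Z ij.1 ij.2) (fun ij =>
  \sum_l (Z ij.1 l * D ij.2 - Z ij.2 l * D ij.1) * d l) X _ _ _ (i, j)) => //=.
  by move=> ij; apply: defect_euler.
move=> k Z0 ij; apply: hord_sum => l _; apply: hordMr; rewrite -add1n.
by apply: hordB; apply: hordM;
  [apply: (Z0 (_, _)) | apply: deform_hord1
  |apply: (Z0 (_, _)) | apply: deform_hord1].
Qed.

Lemma dcoordC i j : X i * X j = X j * X i + K i j.
Proof.
by have /eqP := defect_eq0 i j; rewrite /defect -addrA -opprD subr_eq0 => /eqP.
Qed.

End Commutation.

(** * Bivectors and fixed spaces *)

Section Bivectors.
Context {R : realType} {n : nat}.
Implicit Types (U : {vspace 'cV[R]_n}) (W : 'M[R]_n) (v w : 'cV[R]_n).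

Lemma wedgeE v w i j : wedge v w i j = v i 0 * w j 0 - w i 0 * v j 0.
Proof. by rewrite !mxE !big_ord1 !mxE. Qed.

Lemma in_wedge2_skew U W i j : in_wedge2 U W -> W i j = - W j i.
Proof.
case=> s _ ->; rewrite !summxE -sumrN; apply: eq_bigr => vw _.
rewrite !wedgeE; ring.
Qed.

Lemma dim2_span U : \dim U = 2%N -> exists b1 b2,
  forall v, v \in U -> exists a1 a2, v = a1 *: b1 + a2 *: b2.
Proof.
move=> dimU; exists (vbasis U)`_0, (vbasis U)`_1 => v /coord_vbasis ->.
have sum2 d (c : 'I_d -> R) : d = 2%N -> exists a1 a2,
    \sum_(i < d) c i *: (vbasis U)`_i = a1 *: (vbasis U)`_0 + a2 *: (vbasis U)`_1.
  move=> d2; subst d; exists (c ord0), (c (lift ord0 ord0)).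
  by rewrite big_ord_recl big_ord1.
exact: sum2.
Qed.

(** Three vectors of a plane have vanishing exterior product. *)
Lemma in_wedge2_alt U W w i j l : \dim U = 2%N -> in_wedge2 U W -> w \in U ->
  W j l * w i 0 + W l i * w j 0 + W i j * w l 0 = 0.
Proof.
move=> /dim2_span[b1 [b2 U_span]] [s /allP sU ->] wU.
rewrite !summxE !mulr_suml -!big_split big_seq big1 //= => vw /sU/andP[vU v'U].
have [a1 [a2 ->]] := U_span _ wU.
have [c1 [c2 ->]] := U_span _ vU.
have [c1' [c2' ->]] := U_span _ v'U.
rewrite !wedgeE !mxE; ring.
Qed.

Lemma matrix_of_end_mul (f : 'End('cV[R]_n)) v : matrix_of_end f *m v = f v.
Proof.
apply/matrixP => i k; rewrite ord1 {k} [in RHS](matrix_sum_delta v) mxE.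
rewrite linear_sum summxE; apply: eq_bigr => j _.
by rewrite big_ord1 linearZ !mxE mulrC.
Qed.

Lemma wedge_mul (M : 'M[R]_n) v w :
  M *m wedge v w *m M^T = wedge (M *m v) (M *m w).
Proof. by rewrite /wedge mulmxBr mulmxBl !trmx_mul !mulmxA. Qed.

Lemma in_wedge2_fix U W (M : 'M[R]_n) :
  (forall v, v \in U -> M *m v = v) -> in_wedge2 U W -> M *m W *m M^T = W.
Proof.
move=> M_id [s /allP sU ->]; rewrite mulmx_sumr mulmx_suml big_seq [RHS]big_seq.
by apply: eq_bigr => vw /sU/andP[vU wU]; rewrite wedge_mul !M_id.
Qed.

End Bivectors.

Section FixedSpaces.
Context {R : realType} {gT : finGroupType} {n : nat}.
Context (rG : mx_representation R [set: gT] n).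
Context (ip : {dot 'cV[R]_n for idfun}).

Lemma fixvP g v : reflect (rG g *m v = v) (v \in fixv rG g).
Proof. by rewrite -[X in X = _](lfunE (mulmx (rG g))); apply: fixedSpaceP. Qed.

Lemma fixv_cap_normv g : (fixv rG g :&: normv rG ip g)%VS = 0%VS.
Proof.
apply/eqP; rewrite -subv0; apply/subvP => v; rewrite memv_cap memv0.
case/andP => v_fix /mem_orthovP /(_ _ v_fix) v0.
apply: contraT => v_neq0; have := @neq0_dnorm_gt0 _ _ _ ip v v_neq0.
by rewrite v0 ltxx.
Qed.

Lemma fixv1 : fixv rG 1%g = fullv.
Proof.
apply/eqP; rewrite eqEsubv subvf; apply/subvP => v _; apply/fixvP.
by rewrite repr_mx1 mul1mx.
Qed.

Lemma codim1 : codim rG ip 1%g = 0%N.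
Proof.
have := fixv_cap_normv 1; rewrite fixv1 capfv /codim => ->.
exact: dimv0.
Qed.

Hypothesis ip_inv : invariant_form rG ip.

(** The image of 1 - g^-1 is orthogonal to the kernel of 1 - g, because g is an
    isometry. *)
Lemma sub_act_normv g v : v - rG g^-1%g *m v \in normv rG ip g.
Proof.
apply/mem_orthovP => w /fixvP w_fix; rewrite linearBl.
apply/eqP; rewrite subr_eq0 -[X in _ == X](ip_inv g) w_fix.
by rewrite mulmxA -repr_mxM ?inE // mulgV repr_mx1 mul1mx.
Qed.

Context (pi : gT -> 'M[R]_n).
Hypothesis pi_const : constant_poisson rG ip pi.

Lemma constant_poisson_skew g i j : pi g i j = - pi g j i.
Proof.
have [pi1 pi_norm _] := pi_const.
have [-> | /pi_norm] := eqVneq g 1%g; first exact: in_wedge2_skew pi1.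
by case: ifP => _ => [/in_wedge2_skew | ->] //; rewrite !mxE oppr0.
Qed.

(** The obstruction to the Jacobi identity at g.  The columns of 1 - g^-1 lie
    in N^g, so for l(g) = 2 it is the exterior product of three vectors of a
    plane. *)
Lemma constant_poisson_alt g i j l m :
  pi g j l * (1%:M - rG g^-1%g) i m + pi g l i * (1%:M - rG g^-1%g) j m
  + pi g i j * (1%:M - rG g^-1%g) l m = 0.
Proof.
have [_ pi_norm _] := pi_const.
have [-> | /pi_norm] := eqVneq g 1%g.
  by rewrite invg1 repr_mx1 subrr !mxE !mulr0 !addr0.
case: ifP => [/eqP dim2|_ ->]; last by rewrite !mxE !mul0r !addr0.
have := sub_act_normv g (delta_mx m 0); rewrite -{1}(mul1mx (delta_mx m 0)).
rewrite -mulmxBl -colE; move: (1%:M - _) => M M_norm pi_wedge.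
by have := in_wedge2_alt i j l dim2 pi_wedge M_norm; rewrite !mxE.
Qed.

Lemma restrict_fix_const g : restrict_fix rG ip g (const_polyvector pi g) =
  const_polyvector pi g.
Proof. by apply/matrixP => i j; rewrite !mxE mpoly_lin_const. Qed.

(** Each pi_g lies in the summand of the bivectors on which pr_g is the
    identity. *)
Lemma pr_const g :
  pr rG ip g (const_polyvector pi g) = const_polyvector pi g.
Proof.
have [pi1 pi_norm _] := pi_const; rewrite /pr restrict_fix_const.
have [-> | g1] := eqVneq g 1%g.
  rewrite codim1 /const_polyvector map_trmx -!map_mxM.
  congr (map_mx _ _); apply: in_wedge2_fix pi1 => v v_full.
  by rewrite matrix_of_end_mul daddv_pi_id ?fixv_cap_normv // fixv1.
have := pi_norm g g1; case: ifP => [/eqP -> pi_wedge | _ pi0].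
  rewrite /const_polyvector map_trmx -!map_mxM.
  congr (map_mx _ _); apply: in_wedge2_fix pi_wedge => v v_norm.
  by rewrite matrix_of_end_mul daddv_pi_id // capvC fixv_cap_normv.
rewrite /const_polyvector pi0 map_mx0.
by case: codim => [|[|[|k]]]; rewrite ?(mulmx0, mul0mx, addr0).
Qed.

End FixedSpaces.

(** * Symmetrization *)

Section StarProduct.
Context {R : realType} {gT : finGroupType} {n : nat}.
Context (rG : mx_representation R [set: gT] n).
Local Notation A := (crossed rG).
Local Notation hop := (hop A).
Local Notation d := (hderiv rG).
Local Notation x := (hcoord rG).
Local Notation Eu := (eulerop rG).
Local Notation L := (lgrp rG).
Local Notation Rt := (rgrp rG).
Context (pi : gT -> 'M[R]_n).
Hypothesis pi_skew : forall g i j, pi g i j = - pi g j i.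
Hypothesis pi_equiv :
  forall g h : gT, pi (g * h * g^-1)%g = rG g *m pi h *m (rG g)^T.
Hypothesis pi_alt : forall g i j l m,
  pi g j l * (1%:M - rG g^-1%g) i m + pi g l i * (1%:M - rG g^-1%g) j m
  + pi g i j * (1%:M - rG g^-1%g) l m = 0.

(** The element hbar kappa(x_i, x_j), acting by left multiplication. *)
Definition hkappa i j : hop := \sum_g pi g i j *: (hbar * L g).
Local Notation K := hkappa.

Lemma hkappa_ord i j : hord 1 (K i j).
Proof. by apply: hord_sum => g _; rewrite scalerAr; apply: hord_bar. Qed.

Lemma hkappa_skew i j : K i j = - K j i.
Proof. by rewrite -sumrN; apply: eq_bigr => g _; rewrite pi_skew scaleNr. Qed.

Local Notation D := (deform hkappa_ord).
Local Notation X := (dcoord hkappa_ord).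

Lemma lgrp_hkappa g i j : L g * K i j =
  (\sum_l rG g^-1%g j l *: \sum_m rG g^-1%g i m *: K m l) * L g.
Proof.
pose c h l m := rG g^-1%g j l * (rG g^-1%g i m * pi h m l).
transitivity (\sum_l \sum_m \sum_h c h l m *: (hbar * L h * L g)); last first.
  rewrite mulr_suml; apply: eq_bigr => l _; rewrite scaler_sumr mulr_suml.
  apply: eq_bigr => m _; rewrite !scaler_sumr mulr_suml.
  by apply: eq_bigr => h _; rewrite -!scalerAl !scalerA /c mulrA.
under eq_bigr do rewrite exchange_big.
rewrite exchange_big mulr_sumr (reindex_inj (conjg_inj g)) /=.
apply: eq_bigr => h _.
have -> : pi (h ^ g)%g i j = \sum_l \sum_m c h l m.
  rewrite conjgE mulgA -[X in (_ * X)%g]invgK pi_equiv mxE; apply: eq_bigr => l _.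
  rewrite !mxE mulr_suml; apply: eq_bigr => m _.
  by rewrite /c mulrC.
rewrite -scalerAr scaler_suml; apply: eq_bigr => l _; rewrite scaler_suml.
apply: eq_bigr => m _; congr (_ *: _).
by rewrite mulrA -hbarC -!mulrA -!lgrpM -conjgC.
Qed.

Lemma lgrp_dcoord g i : L g * X i = (\sum_j rG g^-1%g i j *: X j) * L g.
Proof.
under eq_bigr do rewrite dcoordE; rewrite dcoordE.
apply: (deform_coord_twist hkappa_ord) => [i'|l|i' j].
- exact: lgrp_coord.
- exact: hderiv_lgrp.
- exact: lgrp_hkappa.
Qed.

Lemma sum_id_scale (V : lmodType R) i (F : 'I_n -> V) :
  \sum_j (1%:M : 'M[R]_n) i j *: F j = F i.
Proof.
rewrite (bigD1 i) //= mxE eqxx scale1r big1 ?addr0 // => j ji.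
by rewrite mxE eq_sym (negbTE ji) scale0r.
Qed.

Lemma lgrp_rgrp g h : L g * Rt h = Rt h * L g.
Proof. by rewrite lgrpE rgrpE lmul_rmul. Qed.

Lemma rgrp_dcoord g i : Rt g * X i = X i * Rt g.
Proof.
rewrite -[X in _ = X * _](sum_id_scale i (fun i => X i)).
under eq_bigr do rewrite dcoordE; rewrite dcoordE.
apply: (deform_coord_twist hkappa_ord) => [i'|l|i' j].
- by rewrite sum_id_scale hcoordE rgrpE lmul_rmul.
- rewrite hderiv_rgrp -[LHS](sum_id_scale l (fun j => Rt g * d j)).
  by apply: eq_bigr => j _; rewrite !mxE eq_sym.
- rewrite !sum_id_scale mulr_sumr mulr_suml; apply: eq_bigr => h _.
  rewrite -scalerAr -scalerAl mulrA -(hbarC (Rt g)) -!mulrA.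
  by congr (_ *: (_ * _)); rewrite lgrp_rgrp.
Qed.

(** Moving X_i across g in K_jl replaces it by the combination 1 - g^-1 of the
    X_m, whose coefficients cancel in the cyclic sum. *)
Lemma hkappa_jacobi i j l : (X i * K j l - K j l * X i) +
  (X j * K l i - K l i * X j) + (X l * K i j - K i j * X l) = 0.
Proof.
pose M g : 'M[R]_n := 1%:M - rG g^-1%g.
have comm i' j' l' : X i' * K j' l' - K j' l' * X i' =
    \sum_g \sum_m (pi g j' l' * M g i' m) *: (hbar * (X m * L g)).
  rewrite mulr_sumr mulr_suml -sumrB; apply: eq_bigr => g _.
  rewrite -scalerAr -scalerAl -mulrA lgrp_dcoord -scalerBr mulrA -hbarC -mulrA.
  rewrite -mulrBr -mulrBl -{1}(sum_id_scale i' X) -sumrB.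
  rewrite mulr_suml mulr_sumr scaler_sumr; apply: eq_bigr => m _.
  by rewrite -scalerBl -scalerAl -scalerAr scalerA /M !mxE.
rewrite !comm -!big_split big1 // => g _; rewrite -!big_split big1 // => m _ /=.
by rewrite -!scalerDl pi_alt scale0r.
Qed.

Lemma dcoord_comm i j : X i * X j = X j * X i + K i j.
Proof. by apply: dcoordC; [apply: hkappa_skew | apply: hkappa_jacobi]. Qed.


Lemma sum_lgrp_twist (Y : 'I_n -> hop) g : (\sum_l Y l * d l) * L g =
  \sum_j (\sum_l rG g^-1%g j l *: Y l) * L g * d j.
Proof. by apply: sum_deriv_twist => l; apply: hderiv_lgrp. Qed.

(** The solution of Q Eu = sum_j X_j Q d_j with Q g = g b: on a product of
    coordinates it is the average over all orders of the product of the
    deformed coordinates, applied to b. *)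
Definition symmetrize (b : nat -> A) : hop := solve0 X (fun g => L g b).
Local Notation Q := symmetrize.

Lemma symmetrize_euler b : Q b * Eu = \sum_j X j * Q b * d j.
Proof. exact: solve0E. Qed.

Lemma symmetrize_grp b g : Q b (hmono rG g 1) = L g b.
Proof. exact: solve0_1. Qed.

Lemma lgrp_hmono1 g : L g (hmono rG 1%g 1) = hmono rG g 1.
Proof. by rewrite lgrp_mono mulg1 (poly_act_nat rG g 1). Qed.

Lemma dcoord_sum : \sum_j X j * d j = Eu.
Proof. exact: (dcoord_deriv hkappa_ord hkappa_skew). Qed.

(** Since Eu = sum_j X_j d_j, an operator commuting with the X_j solves the
    Euler equation that defines symmetrization. *)
Lemma symmetrize_unique (F : hop) :
    (forall i, F * X i = X i * F) -> (forall g, F * L g = L g * F) ->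
  F = Q (F (hmono rG 1%g 1)).
Proof.
move=> FX FL; apply/eqP; rewrite -subr_eq0; apply/eqP.
apply: (@hop_euler0 _ _ _ rG 0 _ X) => [|]; last first.
  right=> g; rewrite hopB symmetrize_grp -lgrp_hmono1 -!hopM FL.
  by rewrite subrr.
rewrite mulr0n addr0 mulrBl symmetrize_euler -dcoord_sum mulr_sumr -sumrB.
by apply: eq_bigr => j _; rewrite mulrA FX mulrBr mulrBl.
Qed.

Lemma symmetrize_lgrp b g : Q b * L g = L g * Q b.
Proof.
apply/eqP; rewrite -subr_eq0; apply/eqP.
apply: (@hop_euler0 _ _ _ rG 0 _ (fun j => \sum_l rG g^-1%g j l *: X l)) => [|];
    last first.
  right=> h; rewrite hopB !hopM symmetrize_grp -lgrp_hmono1 -[L g _]hopM -lgrpM.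
  by rewrite lgrp_hmono1 symmetrize_grp lgrpM subrr.
have LEu : L g * Eu = Eu * L g.
  rewrite -dcoord_sum sum_lgrp_twist mulr_sumr; apply: eq_bigr => j _.
  by rewrite mulrA lgrp_dcoord.
rewrite mulr0n addr0 mulrBl -mulrA LEu mulrA symmetrize_euler sum_lgrp_twist.
rewrite -mulrA symmetrize_euler mulr_sumr -sumrB; apply: eq_bigr => j _.
rewrite !mulrA lgrp_dcoord mulrBr mulrBl !mulrA; congr (_ * _ * _ - _).
by rewrite mulr_suml; apply: eq_bigr => l _; rewrite scalerAl.
Qed.

Lemma symmetrize_hkappa b i j : Q b * K i j = K i j * Q b.
Proof.
rewrite mulr_sumr mulr_suml; apply: eq_bigr => g _.
by rewrite -scalerAr -scalerAl mulrA -hbarC -!mulrA symmetrize_lgrp.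
Qed.

(** Let W_i be the commutator of Q_b and X_i.  The commutation relations give
    X_i W_j + W_i X_j = X_j W_i + W_j X_i, because Q_b commutes with K_ij.
    Contracting with d_j, where sum_j W_j d_j = 0, turns this into an Euler
    equation for W_i whose remainder involves D_i. *)
Lemma symmetrize_dcoord b i : Q b * X i = X i * Q b.
Proof.
pose W i := Q b * X i - X i * Q b.
suff /(_ i)/eqP : forall i, W i = 0 by rewrite subr_eq0 => /eqP.
have W_deriv0 : \sum_j W j * d j = 0.
  under eq_bigr do rewrite mulrBl -mulrA; rewrite sumrB -mulr_sumr.
  by rewrite dcoord_sum symmetrize_euler subrr.
have W_comm i' j : X i' * W j + W i' * X j = X j * W i' + W j * X i'.
  rewrite /W; have := dcoord_comm i' j; have := symmetrize_hkappa b i' j.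
  move: (X i') (X j) (Q b) (K i' j) => u v q k qk uv.
  have leibniz a c : a * (q * c - c * q) + (q * a - a * q) * c =
      q * (a * c) - a * c * q.
    by rewrite mulrBr mulrBl !mulrA addrC addrA subrK.
  by rewrite !leibniz uv mulrDr mulrDl qk opprD addrACA subrr addr0.
apply: (@hop_euler_family _ _ _ rG _ 1 W (fun i' => \sum_j W j * D i' * d j) X)
   => // [i'|k W0 i']; last first.
  apply: hord_sum => j _; apply: hordMr; rewrite -add1n.
  exact: (hordM (W0 j) (deform_hord1 _ i')).
have : \sum_j (X i' * W j + W i' * X j) * d j =
    \sum_j (X j * W i' + W j * X i') * d j.
  by apply: eq_bigr => j _; rewrite W_comm.
have -> : \sum_j (X i' * W j + W i' * X j) * d j = W i' * Eu.
  under eq_bigr do rewrite mulrDl -!mulrA.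
  by rewrite big_split /= -!mulr_sumr W_deriv0 mulr0 add0r dcoord_sum.
move=> ->; have -> : \sum_j (X j * W i' + W j * X i') * d j =
    \sum_j X j * W i' * d j + (\sum_j W j * x i' * d j + \sum_j W j * D i' * d j).
  rewrite -!big_split; apply: eq_bigr => j _ /=.
  by rewrite (dcoordE _ i') [W j * (_ + _)]mulrDr [LHS]mulrDl [(_ + _) * d j in LHS]mulrDl.
rewrite sum_coord_deriv W_deriv0 mul0r sub0r mulr1n -!addrA; congr (_ + _).
by rewrite addrC addrK.
Qed.

Lemma symmetrize_comp b c : Q c * Q b = Q (Q c b).
Proof.
rewrite [LHS]symmetrize_unique ?hopM ?symmetrize_grp ?lgrp1 ?hop1 // => [i|g].
  by rewrite -mulrA symmetrize_dcoord mulrA symmetrize_dcoord mulrA.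
by rewrite -mulrA symmetrize_lgrp mulrA symmetrize_lgrp mulrA.
Qed.

Lemma symmetrize_rgrp b g : Q (Rt g b) = Rt g * Q b.
Proof.
rewrite [RHS]symmetrize_unique ?hopM ?symmetrize_grp ?lgrp1 ?hop1 // => [i|h].
  by rewrite -mulrA symmetrize_dcoord mulrA rgrp_dcoord mulrA.
by rewrite -mulrA symmetrize_lgrp !mulrA lgrp_rgrp.
Qed.

Lemma symmetrize_lgrp_arg b g : Q (L g b) = Q b * Rt g.
Proof.
rewrite [RHS]symmetrize_unique ?hopM => [|i|h].
- by rewrite rgrp_mono mul1g symmetrize_grp.
- by rewrite -mulrA rgrp_dcoord mulrA symmetrize_dcoord mulrA.
- by rewrite -mulrA -lgrp_rgrp mulrA symmetrize_lgrp mulrA.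
Qed.

Lemma rmul_hcoord a i : rmul a * x i = x i * rmul a.
Proof. by rewrite hcoordE lmul_rmul. Qed.

(** Modulo hbar, symmetrization is the undeformed product. *)
Lemma symmetrize_hord0 (a : A) : hord 1 (Q (hconst a) - rmul a).
Proof.
apply: (@hord_euler _ _ _ rG 1 0 _ (\sum_j D j * rmul a * d j) X).
- rewrite mulr0n addr0 mulrBl symmetrize_euler euleropE mulr_sumr -sumrB.
  rewrite -big_split; apply: eq_bigr => j _ /=.
  rewrite mulrA rmul_hcoord.
  have -> : x j * rmul a = X j * rmul a - D j * rmul a.
    by rewrite dcoordE mulrDl addrK.
  by rewrite mulrBr !mulrBl opprB addrCA addrC.
- apply: hord_sum => j _; do 2!apply: hordMr.
  exact: deform_hord1.
- right => g i _; rewrite hopB symmetrize_grp lgrpE lmul_const rmul_const.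
  by rewrite crossed_grpE subrr.
Qed.

End StarProduct.

(** * The star product *)

Section PowerSeriesScaling.
Context {R : comNzRingType} {A : algType R}.

Lemma hscale_split (c : nat -> R) (u : nat -> A) :
  hscale c u = c 0%N *: u + hshift (hscale (fun k => c k.+1) u).
Proof.
apply/funext => -[|k]; rewrite /hscale !fctE /=; first by rewrite big_ord1 addr0.
by rewrite big_ord_recl.
Qed.

Lemma hop_hscale (f : hop A) (c : nat -> R) u : f (hscale c u) = hscale c (f u).
Proof.
apply/funext => k; elim: k c => [|k IHk] c;
  rewrite hscale_split hop_appD hop_appZ hop_shift (hscale_split c (f u)) !fctE //=.
by rewrite IHk.
Qed.

Fact hscale_lin (c : nat -> R) : hlinear (@hscale R A c).
Proof.
split=> [a u v|u]; last exact: (esym (hop_hscale hbar c u)).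
apply/funext => k; rewrite !fctE /hscale scaler_sumr -big_split /=.
by apply: eq_bigr => i _; rewrite scalerDr !scalerA mulrC.
Qed.

Definition hop_hsc c : hop A := Hop (hscale_lin c).

Lemma hop_hscC c f : hop_hsc c * f = f * hop_hsc c.
Proof. by apply/hopP => u; rewrite !hopE /= hop_hscale. Qed.

End PowerSeriesScaling.

Section Quantization.
Context {R : realType} {gT : finGroupType} {n : nat}.
Context (rG : mx_representation R [set: gT] n).
Local Notation A := (crossed rG).
Local Notation hop := (hop A).
Local Notation L := (lgrp rG).
Context (pi : gT -> 'M[R]_n).
Hypothesis pi_skew : forall g i j, pi g i j = - pi g j i.
Hypothesis pi_equiv :
  forall g h : gT, pi (g * h * g^-1)%g = rG g *m pi h *m (rG g)^T.
Hypothesis pi_alt : forall g i j l m,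
  pi g j l * (1%:M - rG g^-1%g) i m + pi g l i * (1%:M - rG g^-1%g) j m
  + pi g i j * (1%:M - rG g^-1%g) l m = 0.

Local Notation X := (dcoord (hkappa_ord (rG := rG) pi)).
Local Notation Q := (symmetrize (rG := rG) pi).

Let Q_X := symmetrize_dcoord pi_skew pi_equiv pi_alt.
Let Q_L := symmetrize_lgrp pi_skew pi_equiv.

Definition star (u v : nat -> A) : nat -> A := Q v u.

Lemma symmetrize_hscale c v v' :
  Q (hscale c v + v') = hop_hsc c * Q v + Q v'.
Proof.
rewrite [RHS](symmetrize_unique pi_skew) => [|i|g].
- by rewrite hopD hopM !symmetrize_grp lgrp1.
- by rewrite mulrDr mulrDl mulrA -hop_hscC -!mulrA !Q_X.
- by rewrite mulrDr mulrDl mulrA -hop_hscC -!mulrA !Q_L.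
Qed.

Lemma symmetrize_linear c v v' : Q (c *: v + v') = c *: Q v + Q v'.
Proof.
rewrite [RHS](symmetrize_unique pi_skew) => [|i|g].
- by rewrite hopD hopZ !symmetrize_grp lgrp1.
- by rewrite mulrDr mulrDl -scalerAr -scalerAl !Q_X.
- by rewrite mulrDr mulrDl -scalerAr -scalerAl !Q_L.
Qed.

Lemma symmetrizeD v v' : Q (v + v') = Q v + Q v'.
Proof. by have := symmetrize_linear 1 v v'; rewrite !scale1r. Qed.

Lemma symmetrize_hshift v : Q (hshift v) = hbar * Q v.
Proof.
rewrite [RHS](symmetrize_unique pi_skew) => [|i|g].
- by rewrite hopM symmetrize_grp lgrp1.
- by rewrite mulrA -hbarC -!mulrA !Q_X.
- by rewrite mulrA -hbarC -!mulrA !Q_L.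
Qed.

Lemma star_order0 (a : A) u : star u (hconst a) 0%N = u 0%N * a.
Proof.
have := symmetrize_hord0 (rG := rG) pi a u (ltnSn 0); rewrite hopB.
by move/eqP; rewrite subr_eq0 => /eqP.
Qed.

Lemma star_split_r u v : star u v =
  star u (hconst (v 0%N)) + hshift (star u (fun k => v k.+1)).
Proof.
by rewrite /star {1}(hseries_split v) symmetrizeD symmetrize_hshift.
Qed.

Lemma star_split_l u v : star u v =
  star (hconst (u 0%N)) v + hshift (star (fun k => u k.+1) v).
Proof. by rewrite /star {1}(hseries_split u) hop_appD hop_shift. Qed.

Lemma starA u v w : star u (star v w) = star (star u v) w.
Proof. by rewrite /star -(symmetrize_comp pi_skew pi_equiv pi_alt). Qed.

Lemma star_is_star_product : is_star_product star.
Proof.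
split=> [c u u' v|c u v v'|u v w|a b].
- by rewrite -[hadd _ _]/(hscale c u + u') /star hop_appD hop_hscale.
- by rewrite -[hadd _ v']/(hscale c v + v') /star symmetrize_hscale.
- exact: starA.
- exact: star_order0.
Qed.

Local Notation m1 := (star_coef star 1).

(** The coefficient of hbar in the associativity of the product. *)
Lemma star_coef1_cocycle : hochschild_2cocycle m1.
Proof.
split=> [|a b c]; first split=> [b c a a'|a c b b'].
- by rewrite /star_coef /star linearP hop_appD hop_appZ.
- by rewrite /star_coef /star linearP symmetrize_linear.
have := congr1 (fun u : nat -> A => u 1%N) (starA (hconst a) (hconst b) (hconst c)).
rewrite star_split_r [in RHS]star_split_l !fctE /=.
have -> : star (hconst a) (fun k => star (hconst b) (hconst c) k.+1) 0%N =
   a * m1 b c by rewrite star_split_r fctE star_order0 addr0.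
rewrite !star_order0 /hconst /= -!/(hconst _) => E.
by apply/eqP; rewrite subr_eq0 addrAC subr_eq /star_coef addrC E addrC.
Qed.

Lemma rmul_grp_const g (a : A) : rgrp rG g (hconst a) = hconst (a * crossed_grp rG g).
Proof. by rewrite rgrpE rmul_const. Qed.

Lemma lmul_grp_const g (a : A) : L g (hconst a) = hconst (crossed_grp rG g * a).
Proof. by rewrite lgrpE lmul_const. Qed.

Lemma star_coef1_group_bilinear : group_bilinear m1.
Proof.
move=> g a b; rewrite /star_coef /star -rmul_grp_const -!lmul_grp_const; split.
- by rewrite -hopM Q_L hopM [in LHS]lgrpE.
- by rewrite symmetrize_lgrp_arg.
- by rewrite -rmul_grp_const symmetrize_rgrp // rgrpE.
Qed.

Lemma dcoord_one i : X i (hmono rG 1%g 1) = hconst (crossed_poly rG 'X_i).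
Proof.
by rewrite dcoordE hopD hcoord_mono deform1 mulr1 addr0.
Qed.

Lemma star_coord i v : star (hconst (crossed_poly rG 'X_i)) v = X i v.
Proof.
by rewrite -dcoord_one /star -[in LHS]hopM Q_X hopM symmetrize_grp lgrp1.
Qed.

(** Symmetric ordering makes x_i star v equal to X_i v, so the skew part is read
    off from the commutator of X_i and X_j, applied to 1. *)
Lemma skew_part_star g : skew_part m1 g = const_polyvector pi g.
Proof.
apply/matrixP => i j; rewrite !mxE /star_coef !star_coord -!dcoord_one.
set e := hmono rG 1%g 1.
have -> : X i (X j e) = X j (X i e) + hkappa rG pi i j e.
  rewrite -[LHS]hopM -[X j (X i e)]hopM -hopD; congr (hop_fun _ e).
  exact: dcoord_comm.
rewrite -[(_ + _) 1%N]/(X j (X i e) 1%N + hkappa rG pi i j e 1%N).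
rewrite addrAC subrr add0r.
rewrite /hkappa hop_sum fct_sumE sum_ffunE (bigD1 g) //= big1 => [|h hg].
  rewrite addr0 lgrp_hmono1.
  rewrite -[LHS]/((pi g i j *: crossed_mono rG g 1) g) !ffunE eqxx.
  by rewrite alg_mpolyC.
rewrite lgrp_hmono1.
rewrite -[LHS]/((pi h i j *: crossed_mono rG h 1) g) !ffunE.
by rewrite eq_sym (negbTE hg) scaler0.
Qed.

End Quantization.

Theorem theorem3p1 (R : realType) (gT : finGroupType) (n : nat)
    (rG : mx_representation R [set: gT] n)
    (ip : {dot 'cV[R]_n for idfun}) (pi : gT -> 'M[R]_n) :
  mx_faithful rG ->
  invariant_form rG ip ->
  constant_poisson rG ip pi ->
  quantizable rG ip (const_polyvector pi).
Proof.
move=> _ ip_inv pi_const.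
have pi_skew := constant_poisson_skew pi_const.
have pi_alt := constant_poisson_alt ip_inv pi_const.
have [_ _ pi_equiv] := pi_const.
exists (star (rG := rG) pi); first exact: star_is_star_product.
exists (star_coef (star pi) 1); split.
- exact: star_coef1_cocycle.
- exact: star_coef1_group_bilinear.
- exists (fun=> 0) => [a b c|a b]; first by rewrite scaler0 addr0.
  by rewrite subrr mulr0 mul0r subr0 addr0.
- by move=> g; rewrite skew_part_star // pr_const.
Qed.
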